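(* Let $d\ge 3$ be an integer, $\alpha\in[4-d,2)$, and $\nabla K(x)=x|x|^{\alpha-2}$ on $\mathbb{R}^d$. Then any radially symmetric first-kind similarity measure solution $(\mu_t)$ of the aggregation equation $u_t+\operatorname{div}(uv)=0$, $v=-\nabla K*u$, is of the form $$\mu_t(x)=\frac{1}{R(t)^d}\,\mu_0\!\left(\frac{x}{R(t)}\right),$$ where $$\hat\mu_0=m_0\delta_0+m_1\delta_{\rho_1}$$ for some constants $m_0,m_1\ge 0$ and $\rho_1>0$.
   Context: Aggregation equation: $u_t+\operatorname{div}(uv)=0$, $v=-\nabla K*u$ for $x\in\mathbb{R}^d$, $t>0$, with $\nabla K(x)=x|x|^{\alpha-2}$. Let $\mathscr{P}(\mathbb{R}^d)$ be the set of probability measures on $\mathbb{R}^d$. For a radially symmetric $\mu\in\mathscr{P}(\mathbb{R}^d)$, $\hat\mu\in\mathscr{P}([0,\infty))$ is defined by $\hat\mu(I)=\mu(\{x\in\mathbb{R}^d:|x|\in I\})$ for all Borel sets $I\subset[0,\infty)$. The notation $\mu_t(x)=R(t)^{-d}\mu_0(x/R(t))$ means that $\mu_t$ is the push-forward of $\mu_0$ under the dilation $x\mapsto R(t)x$. Velocity of a radially symmetric measure: for radially symmetric $\mu\in\mathscr{P}(\mathbb{R}^d)$ and $x\neq 0$, the velocity $-\nabla K*\mu$ at $x$ is $$V[\mu](x)=-\int_{\mathbb{R}^d}(x-y)|x-y|^{\alpha-2}\,d\mu(y)=-\left(\int_{[0,\infty)}\phi(|x|/\rho)\rho^{\alpha-1}\,d\hat\mu(\rho)\right)\frac{x}{|x|},$$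 where $\phi(r)$, $r\ge 0$, is the average over the unit sphere $S_1=\{y\in\mathbb{R}^d:|y|=1\}$ (with respect to normalized surface measure) of $\frac{r-y_1}{|re_1-y|^{2-\alpha}}$, $e_1=(1,0,\dots,0)$; at $\rho=0$ the integrand is understood as $|x|^{\alpha-1}$ (the contribution of a mass at the origin). At the origin $V[\mu](0)=0$ by symmetry. A radially symmetric first-kind similarity measure solution is a family $\mu_t$ of the form $\mu_t(x)=R(t)^{-d}\mu_0(x/R(t))$, where $\mu_0\in\mathscr{P}(\mathbb{R}^d)$ is radially symmetric and $R>0$ is a differentiable function on a time interval $[0,T_0)$ with $R(0)=1$, such that for every $x\in\operatorname{supp}\mu_0$ the flow map of the velocity field $v(t,\cdot)=V[\mu_t]$ (assumed finite on $\operatorname{supp}\mu_t$) starting at $x$ equals $R(t)x$ at time $t$, i.e. $\frac{d}{dt}(R(t)x)=v(t,R(t)x)$. In particular $V[\mu_0](x)=-\lambda x$ on $\operatorname{supp}\mu_0$ with some constant $\lambda>0$, and, if $\mu_0\ne\delta_0$, $R(t)=(1-t/T_0)^{1/(2-\alpha)}$ with $T_0=(2-\alpha)^{-1}\lambda^{-1}$. *)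

(* Defs.v *)
From HB Require Import structures.
From mathcomp Require Import all_boot all_order all_algebra.
From mathcomp Require Import all_classical all_reals all_analysis.
From mathcomp Require Import measurable_realfun.

Set Implicit Arguments.
Unset Strict Implicit.
Unset Printing Implicit Defensive.

Import Order.TTheory GRing.Theory Num.Theory.
Import numFieldNormedType.Exports.

Local Open Scope classical_set_scope.
Local Open Scope ring_scope.

(* The Borel sigma-algebra of R^d, as the product sigma-algebra: it is generated
   by the coordinate functions, exactly as the library does for d.-tuple R. *)
Definition coord_rV (R : realType) (d : nat) (i : 'I_d) (x : 'rV[R]_d) : R :=
  x ord0 i.

Definition borel_rV_display : measure_display.
Proof. by constructor. Qed.

Section borel_rV.
Variables (R : realType) (d : nat).

Let rV_set0 : g_sigma_preimage (@coord_rV R d) set0.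
Proof. exact: sigma_algebra0. Qed.

Let rV_setC A :
  g_sigma_preimage (@coord_rV R d) A -> g_sigma_preimage (@coord_rV R d) (~` A).
Proof. exact: sigma_algebraC. Qed.

Let rV_bigcup (F : (set 'rV[R]_d)^nat) :
  (forall i, g_sigma_preimage (@coord_rV R d) (F i)) ->
  g_sigma_preimage (@coord_rV R d) (\bigcup_i (F i)).
Proof. exact: sigma_algebra_bigcup. Qed.

HB.instance Definition _ := @isMeasurable.Build borel_rV_display
  'rV[R]_d (g_sigma_preimage (@coord_rV R d)) rV_set0 rV_setC rV_bigcup.

Lemma measurable_coord (i : 'I_d) : measurable_fun setT (@coord_rV R d i).
Proof.
move=> _ Y mY; rewrite setTI; apply: sub_sigma_algebra => /=.
rewrite -bigcup_seq/=; exists i => /=; first by rewrite mem_index_enum.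
by exists Y => //; rewrite setTI.
Qed.

Lemma measurable_fun_rV d1 (T : measurableType d1) (f : T -> 'rV[R]_d) :
  (forall i, measurable_fun setT (fun t => f t ord0 i)) -> measurable_fun setT f.
Proof.
move=> mf.
suff S : g_sigma_preimage (fun i => @coord_rV R d i \o f) `<=` measurable.
  move: S; rewrite g_sigma_preimage_comp => S.
  by move=> _ A mA; apply: S; exists A.
apply: smallest_sub; first exact: sigma_algebra_measurable.
rewrite -bigcup_seq; apply: bigcup_sub => i _ A [B mB <-].
exact: (mf i).
Qed.

End borel_rV.

(* The norm `|x| of the library on 'rV[R]_d is the sup norm (it induces the usual
   topology); the Euclidean structure is the following one. *)
Definition dotv (R : realType) (d : nat) (x y : 'rV[R]_d) : R :=
  \sum_(i < d) x ord0 i * y ord0 i.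

Definition enorm (R : realType) (d : nat) (x : 'rV[R]_d) : R :=
  Num.sqrt (dotv x x).

Lemma measurable_enorm (R : realType) (d : nat) :
  measurable_fun setT (@enorm R d).
Proof.
have mdot : measurable_fun setT (fun x : 'rV[R]_d => dotv x x).
  by apply: measurable_sum => i; apply: measurable_funM; exact: measurable_coord.
apply: (measurableT_comp _ mdot).
by apply: continuous_measurable_fun; exact: sqrt_continuous.
Qed.

HB.instance Definition _ (R : realType) (d : nat) :=
  isMeasurableFun.Build _ _ _ _ (@enorm R d) (@measurable_enorm R d).

Definition glue (R : realType) (n : nat) (p : measurableTypeR R * 'rV[R]_n) : 'rV[R]_n.+1 :=
  @row_mx R 1 1 n (p.1 : R)%:M p.2.

(* Lebesgue measure on R^d: the d-fold product of the Lebesgue measure on R. *)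
Fixpoint lebesgue_rV (R : realType) (d : nat) : set 'rV[R]_d -> \bar R :=
  match d with
  | 0 => \d_(0 : 'rV[R]_0)
  | n.+1 => pushforward
      (product_measure1 (@lebesgue_measure R) (@lebesgue_rV R n)) (@glue R n)
  end.

Section lebesgue_rV.
Variable R : realType.

Lemma measurable_glue n : measurable_fun setT (@glue R n).
Proof.
apply: measurable_fun_rV => i; rewrite /glue.
have [j ->|j ->] := split_ordP (i : 'I_(1 + n)).
  rewrite (_ : (fun _ => _) = fst); first exact: measurable_fst.
  by apply/funext => t; rewrite [LHS](@row_mxEl R 1 1 n) (ord1 j) mxE eqxx mulr1n.
rewrite (_ : (fun _ => _) = @coord_rV R n j \o snd).
  by apply: measurableT_comp; [exact: measurable_coord|exact: measurable_snd].
by apply/funext => t; rewrite [LHS](@row_mxEr R 1 1 n).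
Qed.

Let unglue n (x : 'rV[R]_n.+1) : measurableTypeR R * 'rV[R]_n :=
  (x ord0 ord0, @rsubmx R 1 1 n x).

Let glueK n : cancel (@glue R n) (@unglue n).
Proof.
move=> [a v]; rewrite /unglue /glue row_mxKr; congr pair.
have -> : ord0 = lshift n (ord0 : 'I_1) :> 'I_(1 + n) by apply/val_inj.
by rewrite [LHS](@row_mxEl R 1 1 n) mxE eqxx mulr1n.
Qed.

Let measurable_unglue n : measurable_fun setT (@unglue n).
Proof.
apply: measurable_fun_pair; first exact: (@measurable_coord R n.+1 ord0).
apply: measurable_fun_rV => i.
rewrite (_ : (fun _ => _) = @coord_rV R n.+1 (rshift 1 i)).
  exact: measurable_coord.
by apply/funext => x; rewrite mxE.
Qed.

Lemma lebesgue_rV_measure n :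
  exists m : {sigma_finite_measure set 'rV[R]_n -> \bar R},
    @lebesgue_rV R n = m.
Proof.
elim: n => [|n [m /= ->]]; first by exists \d_(0 : 'rV[R]_0).
pose P : {measure set (measurableTypeR R * 'rV[R]_n)%type -> \bar R} :=
  (@lebesgue_measure R \x m)%E.
pose nu := pushforward P (@glue R n).
have sf : sigma_finite setT nu.
  have /sigma_finiteP[F [TF ndF Foo]] := sigma_finiteT (@lebesgue_measure R).
  have /sigma_finiteP[G [TG ndG Goo]] := sigma_finiteT m.
  exists (fun k => @unglue n @^-1` (F k `*` G k)).
    rewrite -preimage_bigcup -(preimage_setT (@unglue n)); congr (_ @^-1` _).
    rewrite -setXTT TF TG predeqE => -[x y]; split.
      move=> [/= [i _ Fx] [j _ Gy]]; exists (maxn i j) => //; split.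
      - by move: x Fx; exact/subsetPset/ndF/leq_maxl.
      - by move: y Gy; exact/subsetPset/ndG/leq_maxr.
    by move=> [i _ []/= ? ?]; split; exists i.
  move=> k; have [mFk Fk] := Foo k; have [mGk Gk] := Goo k; split.
    rewrite -[X in measurable X]setTI; apply: measurable_unglue => //.
    exact: measurableX.
  rewrite /nu /pushforward -comp_preimage (_ : _ \o _ = id); last first.
    by apply/funext => x /=; rewrite glueK.
  by rewrite preimage_id [ltLHS]product_measure1E// lte_mul_pinfty// ge0_fin_numE.
have [nu' nuE] :
    exists nu' : {measure set 'rV[R]_n.+1 -> \bar R}, nu = nu' :> (set _ -> _).
  by unshelve eexists (pushforward P (@glue R n)); first exact: measurable_glue.
rewrite nuE in sf.
pose M1 := @isSFinite.Build _ _ _ nu' (sfinite_measure_sigma_finite sf).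
pose M2 := @isSigmaFinite.Build _ _ _ nu' sf.
pose M : {sigma_finite_measure set 'rV[R]_n.+1 -> \bar R} :=
  HB.pack (Measure.sort nu') M1 M2.
by exists M; rewrite -[LHS]/nu nuE.
Qed.

End lebesgue_rV.

Section lebesgue_rV_instances.
Variables (R : realType) (d : nat).

Let lebesgue_rV0 : @lebesgue_rV R d set0 = 0%E.
Proof. by have [m ->] := lebesgue_rV_measure R d; exact: measure0. Qed.

Let lebesgue_rV_ge0 A : (0 <= @lebesgue_rV R d A)%E.
Proof. by have [m ->] := lebesgue_rV_measure R d; exact: measure_ge0. Qed.

Let lebesgue_rV_sigma_additive : semi_sigma_additive (@lebesgue_rV R d).
Proof.
have [m ->] := lebesgue_rV_measure R d.
exact: measure_semi_sigma_additive.
Qed.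

HB.instance Definition _ := isMeasure.Build _ _ _ (@lebesgue_rV R d)
  lebesgue_rV0 lebesgue_rV_ge0 lebesgue_rV_sigma_additive.

Let lebesgue_rV_sigma_finite : sigma_finite setT (@lebesgue_rV R d).
Proof. by have [m ->] := lebesgue_rV_measure R d; exact: sigma_finiteT. Qed.

HB.instance Definition _ := @Measure_isSigmaFinite.Build _ _ _
  (@lebesgue_rV R d) lebesgue_rV_sigma_finite.

End lebesgue_rV_instances.

Definition unit_ball (R : realType) (d : nat) : set 'rV[R]_d :=
  [set y | enorm y < 1].

(* The average of f over the unit sphere. The normalized surface measure is the
   cone measure, i.e. the image under y |-> y/|y| of the normalized Lebesgue
   measure of the unit ball (the value at the null point y = 0 is irrelevant). *)
Definition sphere_mean (R : realType) (d : nat) (f : 'rV[R]_d -> R) : R :=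
  (fine (@lebesgue_rV R d (@unit_ball R d)))^-1 *
  \int[@lebesgue_rV R d]_(y in @unit_ball R d) f ((enorm y)^-1 *: y).

Definition e1 (R : realType) (d : nat) : 'rV[R]_d :=
  \row_j ((j : nat) == 0)%N%:R.

(* [dotv y (e1 R d)] is the first coordinate of y. *)
Definition phi (R : realType) (d : nat) (alpha r : R) : R :=
  sphere_mean (fun y : 'rV[R]_d =>
    (r - dotv y (e1 R d)) / enorm (r *: e1 R d - y) `^ (2 - alpha)).

Section radial_measures.
Variables (R : realType) (d : nat).
Implicit Types (mu : probability 'rV[R]_d R) (x : 'rV[R]_d) (alpha : R).

Definition radially_symmetric mu : Prop :=
  forall Q : 'M[R]_d, Q *m Q^T = 1%:M ->
  forall A : set 'rV[R]_d, measurable A ->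
    mu ((fun x => x *m Q) @^-1` A) = mu A.

(* The law of |x| under mu, seen as a measure on R carried by [0, +oo[. *)
Definition radial_law mu : probability R R :=
  distribution mu (@enorm R d).

Definition msupport mu : set 'rV[R]_d :=
  [set x | forall e : R, 0 < e -> (0 < mu [set y | (enorm (y - x) < e)%R])%E].

(* Contribution at distance s = |x| > 0 of the mass at radius rho >= 0. *)
Definition velocity_kernel alpha (s rho : R) : R :=
  if rho == 0 then s `^ (alpha - 1)
  else phi d alpha (s / rho) * rho `^ (alpha - 1).

(* The velocity - grad K * mu at x generated by a radially symmetric mu, with
   grad K (x) = x |x|^(alpha - 2). The convolution integral is taken in polar
   form (first over spheres, then over the radii); for alpha > 1 this is defined
   also for some mu for which y |-> grad K (x - y) is not mu-integrable, and it
   is the same vector whenever y |-> grad K (x - y) is mu-integrable. *)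
Definition velocity alpha mu x : 'rV[R]_d :=
  if x == 0 then 0
  else - (\int[radial_law mu]_(rho in `[0, +oo[)
            velocity_kernel alpha (enorm x) rho) *: ((enorm x)^-1 *: x).

Definition finite_velocity alpha mu x : Prop :=
  x != 0 -> (radial_law mu).-integrable `[0, +oo[
    (fun rho => (velocity_kernel alpha (enorm x) rho)%:E).

End radial_measures.

(* l is the derivative at t of the restriction of f to D. *)
Definition is_derive_within (R : realType) (V : normedModType R) (D : set R)
    (f : R -> V) (t : R) (l : V) : Prop :=
  (fun s => (s - t)^-1 *: (f s - f t)) @ within D t^' --> l.

Definition lifespan (R : realType) (T0 : \bar R) : set R :=
  [set t | 0 <= t /\ (t%:E < T0)%E].

(* nu is the push-forward of mu under the dilation x |-> r x, written
   nu (x) = r^(-d) mu (x / r) for densities. *)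
Definition is_dilation (R : realType) (d : nat) (r : R)
    (mu nu : probability 'rV[R]_d R) : Prop :=
  forall A : set 'rV[R]_d, measurable A ->
    nu A = pushforward mu (fun x => r *: x) A.

Record first_kind_similarity_solution (R : realType) (d : nat) (alpha : R)
    (T0 : \bar R) (rad : R -> R) (mu : R -> probability 'rV[R]_d R) : Prop := {
  fks_lifespan : (0 < T0)%E;
  fks_rad0 : rad 0 = 1;
  fks_rad_gt0 : forall t, lifespan T0 t -> 0 < rad t;
  fks_rad_derivable : forall t, lifespan T0 t ->
    exists l : R^o, is_derive_within (lifespan T0) (rad : R -> R^o) t l;
  fks_symmetric : radially_symmetric (mu 0);
  fks_dilation : forall t, lifespan T0 t -> is_dilation (rad t) (mu 0) (mu t);
  fks_finite : forall t, lifespan T0 t ->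
    forall x, msupport (mu t) x -> finite_velocity alpha (mu t) x;
  (* the flow started at x is t |-> rad t *: x *)
  fks_flow : forall x, msupport (mu 0) x -> forall t, lifespan T0 t ->
    is_derive_within (lifespan T0) (fun s => rad s *: x) t
      (velocity alpha (mu t) (rad t *: x))
}.

(* Main.v *)
Require Import Defs.
From HB Require Import structures.
From mathcomp Require Import all_boot all_order all_algebra.
From mathcomp Require Import all_classical all_reals all_analysis.
From mathcomp Require Import measurable_realfun ring lra.

(** Put [b = (2 - alpha) / 2] and [d = n + 2]. A similarity solution contracts all
points of its support at the same rate, so [s |-> int phi (s / rho) / s * rho ^
(alpha - 1)] takes the same value at all radii [s > 0] of the support. It is
therefore enough that [phi r / r] is nonincreasing, and strictly so beyond [1]: two
radii [s1 < s2] would then leave no mass near [s1].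

In the latitude [x], [phi r] is proportional to [A b r = int (r - sin x) D ^ (- b)
cos ^ n x dx] with [D = r ^ 2 - 2 r sin x + 1] the squared distance, i.e. to the
radial flux of the potential [G b r = int D ^ (- b) cos ^ n x dx]. The divergence
theorem gives [(r ^ (n + 1) A b)' = (n + 2 - 2 b) r ^ (n + 1) G b], and [G b' =
- 2 b A (b + 1)]. As [2 b <= n], the potential is superharmonic: [A (b + 1) >= 0],
which is clear for [r > 1] and follows for [r < 1] by comparison with the Newtonian
exponent [b + 1 = d / 2], for which [A] vanishes inside the sphere. Hence [G b]
decreases, and so does its average [A b r / r] over balls. The integrands stay
bounded at [r = 1] since [D >= cos ^ 2 x]. *)

Set Implicit Arguments.
Unset Strict Implicit.
Unset Printing Implicit Defensive.

Import Order.TTheory GRing.Theory Num.Theory.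
Import numFieldNormedType.Exports.

Local Open Scope classical_set_scope.
Local Open Scope ring_scope.

(** * Integrals over a meridian *)

Section integral_segment.
Context {R : realType}.
Notation mu := (@lebesgue_measure R).

Lemma continuous_integrable_segment (f : R -> R) (p q : R) :
  continuous f -> mu.-integrable `[p, q] (EFin \o f).
Proof.
move=> cf; apply: continuous_compact_integrable; first exact: segment_compact.
exact: continuous_subspaceT.
Qed.

(** On a segment, a constant bounding [f'] uniformly for [r] near [a] is an integrable majorant, so
    differentiation passes under the integral. *)
Lemma is_derive_under_integral_segment (f f' : R -> R -> R) (p q u v a C : R) :
  u < a < v ->
  (forall r, u < r < v -> continuous (f r)) ->
  (forall r x, u < r < v -> is_derive r 1 (f ^~ x) (f' r x)) ->
  (forall r x, u < r < v -> `|f' r x| <= C) ->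
  is_derive a 1 (fun r => \int[mu]_(x in `[p, q]) f r x)
    (\int[mu]_(x in `[p, q]) f' a x).
Proof.
move=> uav cf df f'C.
have d1 r x : u < r < v -> partial1of2 f r x = f' r x.
  by move=> urv; rewrite /partial1of2 derive1E; have [_] := df r x urv.
have C0 : 0 <= C by apply: le_trans (f'C a 0 uav).
have Ia : `]u, v[%classic a by rewrite /= in_itv.
have mI : measurable (`[p, q]%classic : set R) by exact: measurable_itv.
have iC : mu.-integrable `[p, q] (EFin \o (fun=> C)).
  by apply: continuous_integrable_segment => x; exact: cvg_cst.
have if_ r : `]u, v[%classic r -> mu.-integrable `[p, q] (EFin \o f r).
  rewrite /= in_itv/= => urv; exact/continuous_integrable_segment/cf.
have df_ r x : `]u, v[%classic r -> `[p, q]%classic x -> derivable (f ^~ x) r 1.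
  by rewrite /= in_itv/= => urv _; have [] := df r x urv.
have fC_ r x : `]u, v[%classic r -> `[p, q]%classic x ->
    `|partial1of2 f r x| <= C.
  by rewrite /= in_itv/= => urv _; rewrite d1// f'C.
apply: DeriveDef.
  exact: (@derivable_under_integral _ _ _ mu f _ mI a u v Ia if_ df_
    (fun=> C) (fun=> C0) iC fC_).
rewrite -derive1E (@differentiation_under_integral _ _ _ mu f _ mI a u v Ia if_ df_
    (fun=> C) (fun=> C0) iC fC_).
by apply: eq_Rintegral => x _; exact: d1.
Qed.

End integral_segment.

(** A power is monotone, in a direction that depends on the sign of [e]; the sum of the two end
    values bounds it in either case. *)
Lemma powR_le_sum (R : realType) (p q y e : R) :
  0 < p -> p <= y <= q -> y `^ e <= p `^ e + q `^ e.
Proof.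
move=> p0 /andP[py yq]; have y0 : 0 < y by exact: lt_le_trans py.
have q0 : 0 < q by exact: lt_le_trans yq.
have [e0|e0] := leP 0 e.
  rewrite (@le_trans _ _ (q `^ e))// ?lerDr ?powR_ge0//.
  by rewrite ge0_ler_powR// nnegrE ltW.
rewrite (@le_trans _ _ (p `^ e))// ?lerDl ?powR_ge0//.
rewrite -(opprK e) powRN (powRN p) lef_pV2 ?posrE ?powR_gt0//.
have Ne0 : 0 <= - e by rewrite oppr_ge0 ltW.
by apply: (ge0_ler_powR Ne0) => //; rewrite nnegrE ltW.
Qed.

(** * Integrals of powers of the squared distance to the unit sphere *)

Section circle_integrals.
Context {R : realType}.
Notation mu := (@lebesgue_measure R).
Implicit Types (b r x : R) (w : R -> R).

(* Squared distance from [r e_1] to a point of the unit sphere at latitude [x]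
   over the equator orthogonal to [e_1]. *)
Definition sqdist r x : R := (r - sin x) ^+ 2 + cos x ^+ 2.

Lemma sqdistE r x : sqdist r x = r ^+ 2 - 2 * r * sin x + 1.
Proof. by rewrite /sqdist cos2sin2; ring. Qed.

(** A point at distance [|r|] from the origin is at distance at least [|1 - |r||] from the unit
    sphere, so [|r| = 1] is the only possible singularity. *)
Lemma sqdist_lb r x : (1 - `|r|) ^+ 2 <= sqdist r x.
Proof.
rewrite sqdistE sqrrB expr1n mul1r real_normK ?num_real//.
have : r * sin x <= `|r|.
  rewrite (le_trans (ler_norm _))// normrM ler_piMr//.
  by rewrite ler_norml sin_geN1 sin_le1.
by rewrite -mulr_natl; lra.
Qed.

Lemma sqdist_ub r x : sqdist r x <= (1 + `|r|) ^+ 2.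
Proof.
rewrite sqdistE sqrrD expr1n mul1r real_normK ?num_real//.
have : - (r * sin x) <= `|r|.
  rewrite (le_trans (ler_norm _))// normrN normrM ler_piMr//.
  by rewrite ler_norml sin_geN1 sin_le1.
by rewrite -mulr_natl; lra.
Qed.

Lemma sqdist_gt0 r x : `|r| != 1 -> 0 < sqdist r x.
Proof.
move=> r1; apply: lt_le_trans (sqdist_lb r x).
by rewrite exprn_even_gt0//= subr_eq0 eq_sym.
Qed.

Lemma continuous_sqdist r : continuous (sqdist r).
Proof.
move=> x; apply: cvgD; apply: cvgM; try (apply: cvgB; first exact: cvg_cst);
  by [exact: continuous_sin | exact: continuous_cos].
Qed.

Lemma is_derive_sqdist r x : is_derive r 1 (sqdist ^~ x) (2 * (r - sin x)).
Proof.
have -> : sqdist ^~ x = (fun r => (r - sin x) ^+ 2 + cos x ^+ 2) by [].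
by apply: is_derive_eq; rewrite /GRing.scale/=; ring.
Qed.

(** The weight carries the surface measure: at latitude [x] the unit sphere of R^(n + 2) has an
    [n]-dimensional slice of radius [cos x], hence [w x = cos x ^+ n], with a factor [sin x] for the
    first coordinate. *)
Definition sqdist_int b w r : R :=
  \int[mu]_(x in `[- (pi / 2), pi / 2]) (sqdist r x `^ (- b) * w x).

Lemma continuous_sqdist_powR b w r :
  `|r| != 1 -> continuous w -> continuous (fun x => sqdist r x `^ b * w x).
Proof.
move=> r1 cw x; apply: cvgM; last exact: cw.
have : {for x, continuous ((@powR R ^~ b) \o sqdist r)}; last exact.
apply: continuous_comp; first exact: continuous_sqdist.
apply/differentiable_continuous/derivable1_diffP.
by apply: derivable_powR; rewrite in_itv/= andbT sqdist_gt0.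
Qed.

Lemma integrable_sqdist b w r : `|r| != 1 -> continuous w ->
  mu.-integrable `[- (pi / 2), pi / 2]
    (EFin \o (fun x => sqdist r x `^ (- b) * w x)).
Proof.
by move=> r1 cw; apply: continuous_integrable_segment; exact: continuous_sqdist_powR.
Qed.

Lemma sqdist_intD b w1 w2 r : `|r| != 1 -> continuous w1 -> continuous w2 ->
  sqdist_int b (w1 \+ w2) r = sqdist_int b w1 r + sqdist_int b w2 r.
Proof.
move=> r1 c1 c2; rewrite /sqdist_int -RintegralD//; last 2 first.
  exact: integrable_sqdist.
  exact: integrable_sqdist.
by apply: eq_Rintegral => x _; rewrite mulrDr.
Qed.

Lemma sqdist_intZ b w c r : `|r| != 1 -> continuous w ->
  sqdist_int b (fun x => c * w x) r = c * sqdist_int b w r.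
Proof.
move=> r1 c1; rewrite /sqdist_int -RintegralZl//; last exact: integrable_sqdist.
by apply: eq_Rintegral => x _; rewrite mulrCA.
Qed.

(** The integrand has derivative [- 2 b (r - sin x) D ^ (- b - 1) w x] in [r]; away from [|r| = 1]
    the distance [D] stays bounded below locally, which gives the majorant. *)
Lemma is_derive_sqdist_int b w (W : R) r : `|r| != 1 -> continuous w ->
  (forall x, `|w x| <= W) ->
  is_derive r 1 (sqdist_int b w)
    (- (2 * b) * (r * sqdist_int (b + 1) w r
                  - sqdist_int (b + 1) (sin \* w) r)).
Proof.
move=> r1 cw wW.
(* Half the distance from [|r|] to 1: every [s] within [e] of [r] keeps [|s|] at distance at least
   [e] from 1. *)
pose e : R := `|1 - `|r| | / 2.
have e0 : 0 < e by rewrite divr_gt0// normr_gt0 subr_eq0 eq_sym.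
have ball_e (s : R) : r - e < s < r + e -> e <= `|1 - `|s| | /\ `|s| <= `|r| + e.
  move=> /andP[s1 s2].
  have sr : `|s - r| <= e by rewrite ler_norml; apply/andP; split; lra.
  have := ler_dist_dist s r => /le_trans/(_ sr) ?.
  have ? : `|s| <= `|r| + e.
    by rewrite -lerBlDl (le_trans (ler_norm _)).
  split => //.
  have : `|1 - `|r| | <= `|1 - `|s| | + `| `|s| - `|r| |.
    by rewrite (le_trans _ (ler_normD _ _))// addrA subrK.
  have e2 : e * 2 = `|1 - `|r| | by rewrite /e divfK.
  by move: e2 sr; lra.
(* On that neighbourhood [D] lies between [e ^+ 2] and [(1 + |r| + e) ^+ 2]; the sign of the
   exponent is not known, hence a sum. *)
pose K := (e ^+ 2) `^ (- b - 1) + ((1 + (`|r| + e)) ^+ 2) `^ (- b - 1).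
have W0 : 0 <= W by apply: le_trans (wW 0).
have c_sinw : continuous (sin \* w).
  by move=> x; apply: cvgM; [exact: continuous_sin|exact: cw].
have ne1 (s : R) : r - e < s < r + e -> `|s| != 1.
  move=> /ball_e[+ _]; apply: contraTneq => ->.
  by rewrite subrr normr0 -ltNge.
have : is_derive r 1 (fun r => \int[mu]_(x in `[- (pi / 2), pi / 2])
    (sqdist r x `^ (- b) * w x))
  (\int[mu]_(x in `[- (pi / 2), pi / 2])
    (- (2 * b) * (r - sin x) * sqdist r x `^ (- b - 1) * w x)).
  apply: (@is_derive_under_integral_segment _ _
    (fun r x => - (2 * b) * (r - sin x) * sqdist r x `^ (- b - 1) * w x)
    _ _ (r - e) (r + e) _ (`|2 * b| * (`|r| + e + 1) * K * W)).
  - by apply/andP; split; lra.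
  - by move=> s /ne1 s1; exact: continuous_sqdist_powR.
  - move=> s x /ne1 s1; have D0 := sqdist_gt0 x s1.
    have -> : (fun s : R => sqdist s x `^ (- b) * w x) =
        (fun s : R => w x *: ((@powR R ^~ (- b)) \o (sqdist ^~ x)) s).
      by apply/funext => z; rewrite /= mulrC.
    have ? := is_derive_sqdist s x.
    have ? := is_derive1_powR (- b) D0.
    apply: is_derive_eq; rewrite /GRing.scale/=; ring.
  - move=> s x /[dup] sI /ball_e[es se].
    rewrite !normrM normrN -normrM; apply: ler_pM => //.
    apply: ler_pM => //.
      apply: ler_pM => //.
      rewrite (le_trans (ler_normB _ _))// lerD//.
      by rewrite ler_norml sin_geN1 sin_le1.
    rewrite ger0_norm ?powR_ge0//; apply: powR_le_sum.
      by rewrite exprn_gt0.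
    apply/andP; split.
      apply: le_trans (sqdist_lb _ _); rewrite -[leRHS]real_normK ?num_real//.
      by rewrite lerXn2r ?nnegrE// ltW.
    apply: (le_trans (sqdist_ub _ _)).
    rewrite lerXn2r ?nnegrE ?addr_ge0//; first exact: ltW.
    by rewrite lerD2l.
move=> H; apply: (is_derive_eq H).
rewrite {2}/sqdist_int.
rewrite -[r * _]sqdist_intZ// /sqdist_int -RintegralB//; last 2 first.
  apply: integrable_sqdist => // x; apply: cvgM; [exact: cvg_cst|exact: cw].
  exact: integrable_sqdist.
rewrite -RintegralZl//; last first.
  have := @continuous_integrable_segment R (fun x => sqdist r x `^ (- (b + 1)) * (r * w x) -
     sqdist r x `^ (- (b + 1)) * (sin x * w x)) (- (pi / 2)) (pi / 2); apply.
  move=> x; apply: cvgB; apply: continuous_sqdist_powR => //.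
  move=> ?; apply: cvgM; [exact: cvg_cst|exact: cw].
apply: eq_Rintegral => x _ /=; rewrite opprD; ring.
Qed.

Lemma continuous_cosX n : continuous (fun x : R => cos x ^+ n).
Proof.
move=> x; apply: (@continuous_comp R R R cos (@GRing.exp R ^~ n)).
  exact: continuous_cos.
exact: exprn_continuous.
Qed.

(** The function [D ^ (- b) cos ^ (n + 1)] vanishes at both poles, so its derivative in [x] has
    integral zero; the two terms of that derivative are the two sides. *)
Lemma sqdist_int_by_parts n b r : `|r| != 1 ->
  n.+1%:R * sqdist_int b (fun x => sin x * cos x ^+ n) r =
  2 * b * r * sqdist_int (b + 1) (fun x => cos x ^+ n.+2) r.
Proof.
move=> r1.
pose F x := sqdist r x `^ (- b) * cos x ^+ n.+1.
pose f x := 2 * b * r * (sqdist r x `^ (- (b + 1)) * cos x ^+ n.+2) -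
            n.+1%:R * (sqdist r x `^ (- b) * (sin x * cos x ^+ n)).
have ccos k : continuous (fun x : R => cos x ^+ k).
  exact: continuous_cosX.
have csin : continuous (fun x : R => sin x * cos x ^+ n).
  by move=> x; apply: cvgM; [exact: continuous_sin|exact: ccos].
have dF x : is_derive x 1 F (f x).
  have D0 := sqdist_gt0 x r1.
  have dD : is_derive x 1 (sqdist r) (- (2 * r * cos x)).
    have -> : sqdist r = (fun x => (r - sin x) ^+ 2 + cos x ^+ 2) by [].
    by apply: is_derive_eq; rewrite /GRing.scale/=; ring.
  have -> : F = ((@powR R ^~ (- b)) \o sqdist r) * (cos ^+ n.+1).
    by apply/funext => z; rewrite !fctE.
  have ? := is_derive1_powR (- b) D0.
  apply: is_derive_eq; rewrite /GRing.scale/= /f !fctE !exprS -opprD; ring.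
have cf : continuous f.
  by move=> x; apply: cvgB; apply: cvgM; try (exact: cvg_cst);
    exact: continuous_sqdist_powR.
have pi0 := pi_gt0 R.
have FN : F (- (pi / 2)) = 0 by rewrite /F cosN cos_pihalf expr0n mulr0.
have FP : F (pi / 2) = 0 by rewrite /F cos_pihalf expr0n mulr0.
have cF : continuous F.
  by move=> x; apply/differentiable_continuous/derivable1_diffP; case: (dF x).
have ab : - (pi / 2) < pi / 2 :> R by lra.
have := @continuous_FTC2 R f F _ _ ab (continuous_subspaceT cf).
case/(_ _ _)/Wrap => [|x _|].
- split; last 2 first.
  + exact/cvg_at_right_filter/cF.
  + exact/cvg_at_left_filter/cF.
  + by move=> x _; case: (dF x).
- by rewrite derive1E; have [_] := dF x.
rewrite FN FP sube0 => /(congr1 fine)/=.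
rewrite -/(Rintegral _ _ _) /f RintegralB//; last 2 first.
  apply: continuous_integrable_segment => x.
  by apply: cvgM; [exact: cvg_cst|exact: continuous_sqdist_powR].
  apply: continuous_integrable_segment => x.
  by apply: cvgM; [exact: cvg_cst|exact: continuous_sqdist_powR].
rewrite !RintegralZl//; try exact: integrable_sqdist.
by move/eqP; rewrite subr_eq0 => /eqP ->.
Qed.

(* Up to a common factor, the mean of [|r e_1 - y| ^ (- 2 b)] over the unit sphere
   of R^(n + 2), and, in [flux], that of [(r - y_1) |r e_1 - y| ^ (- 2 b)], which is
   [phi r] for [b = (2 - alpha) / 2]. *)
Definition potential n b r : R := sqdist_int b (fun x => cos x ^+ n) r.

Definition flux n b r : R :=
  r * potential n b r - sqdist_int b (fun x => sin x * cos x ^+ n) r.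

Lemma normr_cosX_le1 n x : `|cos x ^+ n| <= 1.
Proof.
by rewrite normrX exprn_ile1// ler_norml cos_geN1 cos_le1.
Qed.

Lemma continuous_sincosX n : continuous (fun x : R => sin x * cos x ^+ n).
Proof.
by move=> x; apply: cvgM; [exact: continuous_sin|exact: continuous_cosX].
Qed.

Lemma normr_sincosX_le1 n x : `|sin x * cos x ^+ n| <= 1.
Proof.
rewrite normrM mulr_ile1// ?normr_cosX_le1//.
by rewrite ler_norml sin_geN1 sin_le1.
Qed.

Lemma is_derive_potential n b r : `|r| != 1 ->
  is_derive r 1 (potential n b) (- (2 * b) * flux n (b + 1) r).
Proof.
move=> r1; exact: (is_derive_sqdist_int b r1 (@continuous_cosX n)
  (@normr_cosX_le1 n)).
Qed.

(** One factor [D = r ^ 2 - 2 r sin x + 1] is split off from [D ^ (- b)], to bring all integrals to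
    the exponent [b + 1]. *)
Lemma potentialSb n b r : `|r| != 1 ->
  potential n b r = (r ^+ 2 + 1) * potential n (b + 1) r
    - 2 * r * sqdist_int (b + 1) (fun x => sin x * cos x ^+ n) r.
Proof.
move=> r1; rewrite /potential -!sqdist_intZ//; last 2 first.
  exact: continuous_sincosX.
  exact: continuous_cosX.
rewrite /sqdist_int -RintegralB//; last 2 first.
  apply: integrable_sqdist => //.
  by move=> x; apply: cvgM; [exact: cvg_cst|exact: continuous_cosX].
  apply: integrable_sqdist => //.
  by move=> x; apply: cvgM; [exact: cvg_cst|exact: continuous_sincosX].
apply: eq_Rintegral => x _.
have D0 := sqdist_gt0 x r1.
have -> : sqdist r x `^ (- b) = sqdist r x * sqdist r x `^ (- (b + 1)).
  rewrite -[X in _ = X * _]powRr1 ?ltW// -powRD; last by rewrite (gt_eqF D0) implybT.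
  by congr (_ `^ _); ring.
by rewrite [X in X * _ * _]sqdistE; ring.
Qed.

(** The divergence of the field, written radially. The derivative is described through [r * l],
    which avoids a division and so includes [r = 0]. *)
Lemma is_derive_flux n b r : `|r| != 1 ->
  exists2 l, is_derive r 1 (flux n b) l &
    r * l = (n.+2%:R - 2 * b) * r * potential n b r - n.+1%:R * flux n b r.
Proof.
move=> r1; have dG := is_derive_potential n b r1.
have dS := is_derive_sqdist_int b r1 (@continuous_sincosX n)
  (@normr_sincosX_le1 n).
eexists.
  have -> : flux n b = id * potential n b -
    sqdist_int b (fun x => sin x * cos x ^+ n) by apply/funext.
  exact: is_deriveB.
rewrite /GRing.scale/= /flux [n.+1%:R * _]mulrBr sqdist_int_by_parts//.
set W := potential n (b + 1) r; set X := sqdist_int (b + 1) (fun x => sin x * cos x ^+ n) r.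
set Z := sqdist_int (b + 1) (fun x => cos x ^+ n.+2) r.
(* Since [sin ^ 2 cos ^ n = cos ^ n - cos ^ (n + 2)], this integral reduces to [W] and to the term
   [Z] produced by the integration by parts. *)
have -> : sqdist_int (b + 1) (sin \* (fun x => sin x * cos x ^+ n)) r = W - Z.
  apply/eqP; rewrite eq_sym subr_eq -sqdist_intD//; last 2 first.
  - by move=> x; apply: cvgM; [exact: continuous_sin|exact: continuous_sincosX].
  - exact: continuous_cosX.
  apply/eqP; apply: eq_Rintegral => x _; rewrite /= !exprS; congr (_ * _).
  rewrite !mulrA -mulrDl -!expr2 addrC cos2Dsin2 mul1r//.
rewrite potentialSb// -/W -/X -[n.+2]addn2 -[n.+1]addn1 !natrD; ring.
Qed.

(** Up to a constant, [r ^+ n.+1 * flux n b r] is the total flux through the sphere of radius [r] in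
    R^(n + 2): this is the divergence theorem in differential form. *)
Lemma is_derive_Xflux n b r : `|r| != 1 ->
  is_derive r 1 (fun r => r ^+ n.+1 * flux n b r)
    ((n.+2%:R - 2 * b) * r ^+ n.+1 * potential n b r).
Proof.
move=> /(is_derive_flux n b)[l dl lE].
have -> : (fun r => r ^+ n.+1 * flux n b r) = id ^+ n.+1 * flux n b.
  by apply/funext => z; rewrite !fctE.
apply: is_derive_eq; rewrite /GRing.scale/= !fctE.
rewrite exprS mulrAC lE mulr1; ring.
Qed.

Section bounded_kernel.
Variables (n : nat) (b : R).
Hypotheses (n0 : (0 < n)%N) (b0 : 0 <= b) (bn : 2 * b <= n%:R).

(* [sqdist r x >= cos x ^+ 2], whatever [r]: no singularity remains at [r = 1]. *)
Lemma normr_sqdist_powR_le1 w r x : `|w x| <= `|cos x| ^+ n ->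
  `|sqdist r x `^ (- b) * w x| <= 1.
Proof.
move=> wc; rewrite normrM ger0_norm ?powR_ge0//.
have [c0|c0] := eqVneq (cos x) 0.
  move: wc; rewrite c0 normr0 expr0n eqn0Ngt n0/= normr_le0 => /eqP ->.
  by rewrite normr0 mulr0 ler01.
have c1 : 0 < `|cos x| by rewrite normr_gt0.
have c2 : `|cos x| <= 1 by rewrite ler_norml cos_geN1 cos_le1.
have D1 : `|cos x| `^ 2 <= sqdist r x.
  by rewrite powR_mulrn// real_normK ?num_real// /sqdist lerDr sqr_ge0.
have D0 : 0 < sqdist r x by apply: lt_le_trans D1; rewrite powR_gt0.
apply: (@le_trans _ _ (`|cos x| `^ (- (2 * b)) * `|cos x| `^ n%:R)).
  apply: ler_pM => //; rewrite ?powR_ge0// ?powR_mulrn//.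
  rewrite !powRN powRrM lef_pV2 ?posrE ?powR_gt0//.
  by apply: (ge0_ler_powR b0) => //; rewrite nnegrE ?powR_ge0 ?ltW.
rewrite -powRD; last by rewrite (gt_eqF c1) implybT.
by rewrite -[leRHS](powRr0 `|cos x|) ger_powR ?c1// addrC subr_ge0.
Qed.

Lemma measurable_sqdist_powR w r : measurable_fun setT w ->
  measurable_fun setT (fun x => sqdist r x `^ (- b) * w x).
Proof.
move=> mw; apply: measurable_funM => //.
apply: (measurableT_comp (measurable_powR _)).
by apply: continuous_measurable_fun; exact: continuous_sqdist.
Qed.

Lemma integrable_sqdist_bounded w r : continuous w ->
  (forall x, `|w x| <= `|cos x| ^+ n) ->
  mu.-integrable `[- (pi / 2), pi / 2]
    (EFin \o (fun x => sqdist r x `^ (- b) * w x)).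
Proof.
move=> cw wc; apply: measurable_bounded_integrable.
- exact: measurable_itv.
- by rewrite /= lebesgue_measure_itv/=; case: ifP => // _; rewrite -EFinB ltry.
- apply: measurable_funTS; apply: measurable_sqdist_powR.
  exact: continuous_measurable_fun.
- exists 1; split => // M M1 x _.
  by rewrite /= (le_trans _ (ltW M1))// normr_sqdist_powR_le1.
Qed.

(** Dominated convergence with majorant 1. This includes [r = 1] and so joins the regions inside and
    outside the sphere. *)
Lemma continuous_sqdist_int w : continuous w ->
  (forall x, `|w x| <= `|cos x| ^+ n) -> continuous (sqdist_int b w).
Proof.
move=> cw wc r.
have mI : measurable (`[- (pi / 2), pi / 2]%classic : set R).
  exact: measurable_itv.
apply: (@continuity_under_integral _ _ _ mu
  (fun r x => sqdist r x `^ (- b) * w x) _ mI (r - 1) (r + 1) _ _ (fun=> 1)).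
- by move=> s _; exact: integrable_sqdist_bounded.
(* Only at the two poles, where [cos x = 0], can [D] vanish and continuity in [r] fail. *)
- have : mu.-negligible [set - (pi / 2 : R); pi / 2].
    exists [set - (pi / 2 : R); pi / 2]; split => //; first exact: measurableU.
    by apply: countable_lebesgue_measure0; exact: finite_set_countable.
  apply: negligibleS => x /= /not_implyP[].
  rewrite in_itv/= => /andP[x1 x2] nc; apply: contrapT => /not_orP[/eqP x3 /eqP x4].
  apply: nc => s _.
  have cx : 0 < cos x.
    by rewrite cos_gt0_pihalf// !lt_neqAle x1 x2 x4 eq_sym x3.
  apply: cvgM; last exact: cvg_cst.
  have : {for s, continuous ((@powR R ^~ (- b)) \o (sqdist ^~ x))}; last exact.
  apply: continuous_comp.
    apply/differentiable_continuous/derivable1_diffP.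
    by case: (is_derive_sqdist s x).
  apply/differentiable_continuous/derivable1_diffP/derivable_powR.
  rewrite in_itv/= andbT /sqdist (@lt_le_trans _ _ (cos x ^+ 2))//.
    by rewrite exprn_gt0.
  by rewrite lerDr sqr_ge0.
- by apply: continuous_integrable_segment => x; exact: cvg_cst.
- by move=> s _; apply/aeW => x _; exact: normr_sqdist_powR_le1.
- by rewrite inE/= in_itv/=; apply/andP; split; lra.
Qed.

End bounded_kernel.

End circle_integrals.

(** * Sign of the flux inside and outside the unit sphere *)

Section flux.
Context {R : realType}.
Notation mu := (@lebesgue_measure R).
Implicit Types (b r x : R) (n : nat).

Lemma continuous_subsinX n r : continuous (fun x : R => (r - sin x) * cos x ^+ n).
Proof.
move=> x; apply: cvgM; last exact: continuous_cosX.
by apply: cvgB; [exact: cvg_cst|exact: continuous_sin].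
Qed.

Lemma fluxE n b r : `|r| != 1 ->
  flux n b r = sqdist_int b (fun x => (r - sin x) * cos x ^+ n) r.
Proof.
move=> r1; rewrite /flux /potential -sqdist_intZ//; last exact: continuous_cosX.
rewrite /sqdist_int -RintegralB//; last 2 first.
  apply: integrable_sqdist => //.
  by move=> x; apply: cvgM; [exact: cvg_cst|exact: continuous_cosX].
  by apply: integrable_sqdist => //; exact: continuous_sincosX.
by apply: eq_Rintegral => x _; ring.
Qed.

Lemma continuous_within_segment (f : R -> R) (p q : R) :
  (forall r, p <= r <= q -> {for r, continuous f}) ->
  {within `[p, q], continuous f}.
Proof.
move=> cf; apply: continuous_in_subspaceT => x; rewrite inE/= in_itv/=.
exact: cf.
Qed.

Lemma is_derive_continuous (f : R -> R) (r l : R) :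
  is_derive r 1 f l -> {for r, continuous f}.
Proof. by case=> df _; exact/differentiable_continuous/derivable1_diffP. Qed.

(* Newton's theorem: for the exponent of the Newtonian field there is no force
   inside the shell. *)
Lemma flux_newtonian n r : 0 < r < 1 -> flux n (n.+2%:R / 2) r = 0.
Proof.
move=> /andP[r0 r1]; pose h r := r ^+ n.+1 * flux n (n.+2%:R / 2) r.
have s1 s : 0 <= s <= r -> `|s| != 1.
  by move=> /andP[s0 sr]; rewrite ger0_norm// lt_eqF// (le_lt_trans sr).
have dh s : 0 <= s <= r -> is_derive s 1 h 0.
  move=> /s1 /(is_derive_Xflux n (n.+2%:R / 2)) H; apply: (is_derive_eq H).
  by rewrite mulrCA divff// mulr1 subrr !mul0r.
have dh' s : s \in `]0, r[ -> is_derive s 1 h 0.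
  by rewrite in_itv/= => /andP[s0 s2]; apply: dh; rewrite !ltW.
have ch : {within `[0, r], continuous h}.
  by apply: continuous_within_segment => s /dh; exact: is_derive_continuous.
have [c _] := MVT_segment (ltW r0) dh' ch.
rewrite mul0r /h [0 ^+ _]expr0n mul0r subr0 => /eqP.
by rewrite mulf_eq0 expf_eq0/= (gt_eqF r0)/= => /eqP.
Qed.

(* [(r - sin x) * (D ^ g - (1 - r^2) ^ g) >= 0] because [D - (1 - r^2)] is
   [2 r (r - sin x)]; this compares the field with the Newtonian one. *)
Lemma flux_ge0_lt1 n b r : 2 * b <= n%:R -> 0 < r < 1 -> 0 <= flux n (b + 1) r.
Proof.
move=> bn r01; have /andP[r0 r1] := r01.
have nr1 : `|r| != 1 by rewrite ger0_norm ?ltW// lt_eqF.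
pose g : R := n.+2%:R / 2 - (b + 1).
have g0 : 0 <= g.
  by rewrite /g -[n.+2]addn2 natrD subr_ge0; move: bn; lra.
pose D0 : R := 1 - r ^+ 2.
have D00 : 0 < D0 by rewrite subr_gt0 expr_lt1// ltW.
have -> : 0 = D0 `^ g * flux n (n.+2%:R / 2) r by rewrite flux_newtonian// mulr0.
rewrite !fluxE// -sqdist_intZ//; last exact: continuous_subsinX.
apply: le_Rintegral => //.
- apply: integrable_sqdist => // x; apply: cvgM; first exact: cvg_cst.
  exact: continuous_subsinX.
- by apply: integrable_sqdist => //; exact: continuous_subsinX.
move=> x; rewrite /= in_itv/= => xI.
have D := sqdist_gt0 x nr1.
have -> : - (b + 1) = - (n.+2%:R / 2) + g by rewrite /g; ring.
rewrite (@powRD _ (sqdist r x)); last by rewrite (gt_eqF D) implybT.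
rewrite -mulrA ler_wpM2l ?powR_ge0//.
rewrite !mulrA ler_wpM2r ?exprn_ge0 ?cos_ge0_pihalf//.
have DE : sqdist r x - D0 = 2 * r * (r - sin x) by rewrite sqdistE /D0; ring.
have [rs|rs] := leP (sin x) r.
  rewrite ler_wpM2r ?subr_ge0//; apply: (ge0_ler_powR g0); rewrite ?nnegrE ?(ltW D00) ?(ltW D)//.
  by rewrite -subr_ge0 DE !mulr_ge0 ?subr_ge0 ?(ltW r0).
rewrite ler_wnM2r ?subr_le0 ?(ltW rs)//.
apply: (ge0_ler_powR g0); rewrite ?nnegrE ?(ltW D00) ?(ltW D)//.
by rewrite -subr_le0 DE pmulr_rle0 ?mulr_gt0// subr_le0 ltW.
Qed.

(** On [[0, pi / 4]] the integrand is at least [cos (pi / 4) ^+ n], and it is nonnegative elsewhere.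
    This integral normalizes the averages over the sphere. *)
Lemma integral_cosX_gt0 n : 0 < \int[mu]_(x in `[- (pi / 2), pi / 2]) (cos x ^+ n).
Proof.
have pi0 := pi_gt0 R.
have icos p q : mu.-integrable `[p, q] (EFin \o (fun x => cos x ^+ n)).
  by apply: continuous_integrable_segment; exact: continuous_cosX.
have c0 : 0 < cos (pi / 4) :> R by apply: cos_gt0_pihalf; apply/andP; split; lra.
suff : ((cos (pi / 4) ^+ n * (pi / 4))%:E <=
    \int[mu]_(x in `[(- (pi / 2))%R, (pi / 2)%R]) (cos x ^+ n)%:E)%E.
  rewrite /Rintegral => H; rewrite fine_gt0// (lt_le_trans _ H)/=; last first.
    by rewrite lte_fin mulr_gt0 ?exprn_gt0// divr_gt0.
  by have /integrable_fin_num := icos (- (pi / 2)) (pi / 2) => /(_ (measurable_itv _)) /fin_numPlt /andP[].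
apply: (@le_trans _ _ (\int[mu]_(x in `[0%R, (pi / 4)%R]) (cos x ^+ n)%:E)%E).
  have -> : (cos (pi / 4) ^+ n * (pi / 4))%:E =
      (\int[mu]_(x in `[0%R, (pi / 4)%R]) (cos (pi / 4) ^+ n)%:E)%E.
    rewrite integral_cst//= lebesgue_measure_itv/= lte_fin divr_gt0//.
    by rewrite oppr0 adde0 EFinM.
  apply: ge0_le_integral => //.
  - by move=> x _; rewrite lee_fin exprn_ge0// ltW.
  - by have /measurable_int := icos 0 (pi / 4).
  - move=> x; rewrite /= in_itv/= => /andP[x0 x1].
    rewrite lee_fin; apply: lerXn2r; rewrite ?nnegrE ?(ltW c0)//.
      by apply: cos_ge0_pihalf; apply/andP; split; lra.
    by rewrite leNgt ltr_cos ?in_itv/= -?leNgt//; apply/andP; split; lra.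
apply: ge0_subset_integral => //=.
- by have /measurable_int := icos (- (pi / 2)) (pi / 2).
- by move=> x; rewrite /= in_itv/= => xI; rewrite lee_fin exprn_ge0// cos_ge0_pihalf.
- by apply: subset_itv; rewrite bnd_simp; lra.
Qed.

Lemma flux_gt0_gt1 n b r : 0 <= b -> 1 < r -> 0 < flux n b r.
Proof.
move=> b0 r1; have r0 : 0 < r by lra.
have nr1 : `|r| != 1 by rewrite ger0_norm ?gt_eqF// ltW.
(* Lower bound of [D ^ (- b) (r - sin x)], from [D <= (1 + |r|) ^ 2] and [sin x <= 1]. *)
pose K := ((1 + `|r|) ^+ 2) `^ (- b) * (r - 1).
have K0 : 0 < K by rewrite mulr_gt0 ?subr_gt0// powR_gt0// exprn_gt0// ltr_pwDl.
apply: (@lt_le_trans _ _ (K * \int[mu]_(x in `[- (pi / 2), pi / 2]) (cos x ^+ n))).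
  by rewrite mulr_gt0// integral_cosX_gt0.
have icos : mu.-integrable `[- (pi / 2), pi / 2] (EFin \o (fun x => cos x ^+ n)).
  by apply: continuous_integrable_segment; exact: continuous_cosX.
rewrite -RintegralZl// fluxE//; apply: le_Rintegral => //.
- apply: continuous_integrable_segment => x.
  by apply: cvgM; [exact: cvg_cst|exact: continuous_cosX].
- by apply: integrable_sqdist => //; exact: continuous_subsinX.
move=> x; rewrite /= in_itv/= => xI.
have D := sqdist_gt0 x nr1.
rewrite mulrA ler_wpM2r ?exprn_ge0 ?cos_ge0_pihalf//.
apply: ler_pM; rewrite ?powR_ge0 ?subr_ge0 ?(ltW r1)//.
  rewrite !powRN lef_pV2 ?posrE ?powR_gt0// ?exprn_gt0 ?ltr_pwDl//.
  by apply: (ge0_ler_powR b0); rewrite ?nnegrE ?exprn_ge0 ?(ltW D)// sqdist_ub.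
by rewrite lerD2l lerN2 sin_le1.
Qed.

End flux.

(** * Monotonicity of the flux *)

Section flux_monotone.
Context {R : realType}.
Variables (n : nat) (b : R).
Hypotheses (n0 : (0 < n)%N) (b0 : 0 < b) (bn : 2 * b <= n%:R).
Implicit Types (r p q : R).

Lemma continuous_potential : continuous (@potential R n b).
Proof.
apply: (continuous_sqdist_int n0 (ltW b0) bn); first exact: continuous_cosX.
by move=> x; rewrite normrX.
Qed.

Lemma sincosX_le x : `|sin x * cos x ^+ n| <= `|cos x| ^+ n :> R.
Proof.
by rewrite normrM normrX ler_piMl ?exprn_ge0// ler_norml sin_geN1 sin_le1.
Qed.

Lemma continuous_flux : continuous (@flux R n b).
Proof.
move=> r; apply: cvgB.
  by apply: cvgM; [exact: cvg_id|exact: continuous_potential].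
apply: (continuous_sqdist_int n0 (ltW b0) bn); first exact: continuous_sincosX.
exact: sincosX_le.
Qed.

(* Up to a positive factor, [- excess r / r ^+ n.+3] is the derivative of
   [flux r / r], and [excess] is the integral of a multiple of
   [r ^+ n.+2 * flux n (b + 1) r], whose sign is known. *)
Definition excess r : R := n.+2%:R * (r ^+ n.+1 * flux n b r) -
  (n.+2%:R - 2 * b) * (r ^+ n.+2 * potential n b r).

(** The coefficients in [excess] are chosen so that the terms in [r ^+ n.+1 * potential n b r]
    cancel; only the derivative of the potential remains. *)
Lemma is_derive_excess r : `|r| != 1 -> is_derive r 1 excess
  ((n.+2%:R - 2 * b) * (2 * b) * r ^+ n.+2 * flux n (b + 1) r).
Proof.
move=> r1; have d1 := is_derive_Xflux n b r1.
have d2 := is_derive_potential n b r1.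
have -> : excess = n.+2%:R *: (fun r => r ^+ n.+1 * flux n b r) -
    (n.+2%:R - 2 * b) *: (id ^+ n.+2 * potential n b).
  by apply/funext => z; rewrite !fctE.
apply: is_derive_eq; rewrite /GRing.scale/= !fctE !exprS; ring.
Qed.

Lemma continuous_excess : continuous excess.
Proof.
move=> r; apply: cvgB.
  apply: cvgM; first exact: cvg_cst.
  by apply: cvgM; [exact: exprn_continuous|exact: continuous_flux].
apply: cvgM; first exact: cvg_cst.
by apply: cvgM; [exact: exprn_continuous|exact: continuous_potential].
Qed.

Let coef_gt0 : 0 < (n.+2%:R - 2 * b) * (2 * b).
Proof. by rewrite mulr_gt0 ?mulr_gt0// -[n.+2]addn2 natrD; move: bn; lra. Qed.

Lemma excess_ge0_le1 r : 0 <= r <= 1 -> 0 <= excess r.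
Proof.
move=> /andP[r0 r1].
have n1 (s : R) : s \in `]0, 1[ -> `|s| != 1.
  by rewrite in_itv/= => /andP[s0 s1]; rewrite ger0_norm ?lt_eqF// ltW.
(* The excess starts from 0 at the origin and is nondecreasing up to 1. *)
have <- : excess 0 = 0.
  by rewrite /excess !expr0n/= !mul0r !mulr0 subrr.
apply: (@ger0_derive1_le_cc R excess 0 1 _ _ _ 0 r _ _ r0); last 3 first.
- exact/continuous_subspaceT/continuous_excess.
- by rewrite in_itv/= lexx ler01.
- by rewrite in_itv/= r0 r1.
- by move=> s /n1 /is_derive_excess[].
move=> s sI; rewrite derive1E; have [_ ->] := is_derive_excess (n1 _ sI).
move: sI; rewrite in_itv/= => sI.
rewrite mulr_ge0// ?flux_ge0_lt1// mulr_ge0 ?(ltW coef_gt0)// exprn_ge0//.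
by case/andP: sI => /ltW.
Qed.

Lemma excess_gt0_gt1 r : 1 < r -> 0 < excess r.
Proof.
move=> r1.
have n1 (s : R) : s \in `]1, r[ -> `|s| != 1.
  rewrite in_itv/= => /andP[s1 _].
  by rewrite gtr0_norm ?(lt_trans ltr01 s1)// gt_eqF.
(* Continuity has carried the sign up to [r = 1]; beyond it the derivative is strictly positive. *)
have E1 : 0 <= excess 1 by rewrite excess_ge0_le1// ler01 lexx.
apply: (le_lt_trans E1).
apply: (@gtr0_derive1_lt_cc R excess 1 r _ _ _ 1 r _ _ r1); last 3 first.
- exact/continuous_subspaceT/continuous_excess.
- by rewrite in_itv/= lexx ltW.
- by rewrite in_itv/= lexx ltW.
- by move=> s /n1 /is_derive_excess[].
move=> s sI; rewrite derive1E; have [_ ->] := is_derive_excess (n1 _ sI).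
move: sI; rewrite in_itv/= => /andP[s1 _].
apply: mulr_gt0; last by apply: flux_gt0_gt1 => //; rewrite addr_ge0 ?ltW.
by rewrite mulr_gt0 ?coef_gt0// exprn_gt0// (lt_trans ltr01 s1).
Qed.

Lemma is_derive_flux_div r : 0 < r -> r != 1 ->
  is_derive r 1 (fun r => flux n b r / r) (- (excess r / r ^+ n.+3)).
Proof.
move=> r0 r1; have nr1 : `|r| != 1 by rewrite gtr0_norm.
have [l dl lE] := is_derive_flux n b nr1.
have -> : (fun r => flux n b r / r) = flux n b * (fun r => r^-1).
  by apply/funext.
have rN0 : r != 0 by rewrite gt_eqF.
have dV : is_derive r 1 (fun r : R => r^-1) (- r ^- 2 *: (1 : R)).
  exact: (@is_deriveV R id).
apply: is_derive_eq; rewrite /GRing.scale/=.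
have -> : l = ((n.+2%:R - 2 * b) * r * potential n b r - n.+1%:R * flux n b r) / r.
  by rewrite -lE mulrC mulKf.
rewrite /excess !exprS expr0 -[n.+2]addn2 -[n.+1]addn1 !natrD.
have : r ^+ n != 0 by rewrite expf_neq0.
move: (r ^+ n) (n%:R : R) (potential n b r) (flux n b r) => P N G A P0.
by field; rewrite rN0 P0.
Qed.

Let continuous_flux_div r : 0 < r -> {for r, continuous (fun r => flux n b r / r)}.
Proof.
move=> r0; apply: cvgM; first exact: continuous_flux.
by apply: cvgV; [rewrite gt_eqF|exact: cvg_id].
Qed.

Let flux_div_le1 p q : 0 < p -> p <= q -> q <= 1 -> flux n b q / q <= flux n b p / p.
Proof.
move=> p0 pq q1.
have n1 (s : R) : s \in `]p, 1[ -> 0 < s /\ s != 1.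
  rewrite in_itv/= => /andP[ps s1]; split; last by rewrite lt_eqF.
  exact: lt_trans ps.
apply: (@ler0_derive1_le_cc R (fun r => flux n b r / r) p 1) => //.
- by move=> s /n1[s0 s1]; case: (is_derive_flux_div s0 s1).
- move=> s /[dup] sI /n1[s0 s1].
  rewrite derive1E; have [_ ->] := is_derive_flux_div s0 s1.
  rewrite oppr_le0 divr_ge0 ?exprn_ge0 ?(ltW s0)// excess_ge0_le1//.
  by move: sI; rewrite in_itv/= => /andP[_ s1']; rewrite !ltW.
- apply: continuous_within_segment => s /andP[ps _].
  by apply: continuous_flux_div; exact: lt_le_trans ps.
- by rewrite in_itv/= pq q1.
- by rewrite in_itv/= lexx (le_trans pq).
Qed.

Let flux_div_gt1 p q : 1 <= p -> p < q -> flux n b q / q < flux n b p / p.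
Proof.
move=> p1 pq.
have n1 (s : R) : s \in `]p, q[ -> 1 < s.
  by rewrite in_itv/= => /andP[ps _]; exact: le_lt_trans ps.
apply: (@ltr0_derive1_lt_cc R (fun r => flux n b r / r) p q) => //.
- move=> s /n1 s1; have s0 : 0 < s by lra.
  by case: (is_derive_flux_div s0 (negbT (gt_eqF s1))).
- move=> s /n1 s1; have s0 : 0 < s by lra.
  rewrite derive1E; have [_ ->] := is_derive_flux_div s0 (negbT (gt_eqF s1)).
  by rewrite oppr_lt0 divr_gt0 ?exprn_gt0// excess_gt0_gt1.
- apply: continuous_within_segment => s /andP[ps _].
  by apply: continuous_flux_div; lra.
- by rewrite in_itv/= lexx ltW.
- by rewrite in_itv/= lexx ltW.
Qed.

Lemma flux_div_decreasing p q : 0 < p -> p < q -> 1 < q ->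
  flux n b q / q < flux n b p / p.
Proof.
move=> p0 pq q1; have [p1|p1] := leP 1 p; first exact: flux_div_gt1.
(* For [p < 1 < q] the value at 1 separates the two: a strict comparison on [[1, q]], a weak one on
   [[p, 1]]. *)
apply: (@lt_le_trans _ _ (flux n b 1 / 1)); first exact: flux_div_gt1.
by apply: flux_div_le1 => //; exact: ltW.
Qed.

Lemma flux_div_nonincreasing p q : 0 < p -> p <= q ->
  flux n b q / q <= flux n b p / p.
Proof.
move=> p0; rewrite le_eqVlt => /predU1P[<-//|pq].
have [q1|q1] := leP q 1; first by apply: flux_div_le1 => //; exact: ltW.
by apply/ltW/flux_div_decreasing.
Qed.

End flux_monotone.

(** * Lebesgue measure and cylindrical coordinates *)

Section euclidean_norm.
Context {R : realType}.
Implicit Types (n : nat) (a s : R).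

Lemma dotvv_ge0 n (v : 'rV[R]_n) : 0 <= dotv v v.
Proof. by apply: sumr_ge0 => i _; rewrite -expr2 sqr_ge0. Qed.

Lemma enorm_ge0 n (v : 'rV[R]_n) : 0 <= enorm v.
Proof. exact: sqrtr_ge0. Qed.

Lemma sqr_enorm n (v : 'rV[R]_n) : enorm v ^+ 2 = dotv v v.
Proof. by rewrite sqr_sqrtr// dotvv_ge0. Qed.

Lemma enorm_eq0 n (v : 'rV[R]_n) : (enorm v == 0) = (v == 0).
Proof.
rewrite -[LHS]sqrf_eq0 sqr_enorm /dotv psumr_eq0; last first.
  by move=> i _; rewrite -expr2 sqr_ge0.
apply/allP/eqP => [v0|-> i _]; last by rewrite mxE mulr0 eqxx.
apply/rowP => i; rewrite mxE; apply/eqP.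
by have := v0 i (mem_index_enum _); rewrite mulf_eq0 orbb.
Qed.


Lemma dotvZ n s (v : 'rV[R]_n) : dotv (s *: v) (s *: v) = s ^+ 2 * dotv v v.
Proof.
by rewrite /dotv mulr_sumr; apply: eq_bigr => i _; rewrite !mxE; ring.
Qed.

Lemma enormZ n s (v : 'rV[R]_n) : 0 <= s -> enorm (s *: v) = s * enorm v.
Proof.
by move=> s0; rewrite /enorm dotvZ sqrtrM ?sqr_ge0// sqrtr_sqr ger0_norm.
Qed.

Lemma coord_glue0 n a (v : 'rV[R]_n) : Defs.glue (a, v) ord0 ord0 = a.
Proof.
rewrite /Defs.glue; have -> : ord0 = lshift n (ord0 : 'I_1) :> 'I_(1 + n) by apply/val_inj.
by rewrite [LHS](@row_mxEl R 1 1 n) mxE eqxx mulr1n.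
Qed.

Lemma coord_glueS n a (v : 'rV[R]_n) i : Defs.glue (a, v) ord0 (lift ord0 i) = v ord0 i.
Proof.
rewrite /Defs.glue; have -> : lift ord0 i = rshift 1 i :> 'I_(1 + n) by apply/val_inj.
by rewrite [LHS](@row_mxEr R 1 1 n).
Qed.

Lemma dotv_glue n a (v : 'rV[R]_n) :
  dotv (Defs.glue (a, v)) (Defs.glue (a, v)) = a ^+ 2 + dotv v v.
Proof.
rewrite /dotv big_ord_recl coord_glue0 -expr2; congr (_ + _).
by apply: eq_bigr => i _; rewrite coord_glueS.
Qed.

Lemma scale_glue n s a (v : 'rV[R]_n) : s *: Defs.glue (a, v) = Defs.glue (s * a, s *: v).
Proof.
apply/rowP => i; have [j ->|->] := unliftP ord0 i.
  by rewrite mxE !coord_glueS mxE.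
by rewrite mxE !coord_glue0.
Qed.

Lemma measurable_scalerv n s : measurable_fun setT (fun v : 'rV[R]_n => s *: v).
Proof.
apply: measurable_fun_rV => i.
rewrite (_ : (fun _ => _) = (fun v : 'rV[R]_n => s * coord_rV i v)).
  by apply: measurable_funM => //; exact: measurable_coord.
by apply/funext => v; rewrite mxE.
Qed.

End euclidean_norm.

Section lebesgue_rV_integral.
Context {R : realType}.
Notation mu := (@lebesgue_measure R).
Local Open Scope ereal_scope.

Let measurable_comp_glue n (f : 'rV[R]_n.+1 -> \bar R) :
  measurable_fun setT f -> measurable_fun setT (f \o @Defs.glue R n).
Proof. by move=> mf; exact: (measurableT_comp mf (@measurable_glue R n)). Qed.

Lemma ge0_integral_glue n (f : 'rV[R]_n.+1 -> \bar R) :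
  measurable_fun setT f -> (forall y, 0 <= f y) ->
  \int[@lebesgue_rV R n.+1]_y f y =
  \int[mu]_a \int[@lebesgue_rV R n]_v f (Defs.glue (a, v)).
Proof.
move=> mf f0.
transitivity (\int[mu \x @lebesgue_rV R n]_z (f \o @Defs.glue R n) z).
  have := @ge0_integral_pushforward _ _ _ _ R _ (@measurable_glue R n)
    (mu \x @lebesgue_rV R n) setT f measurableT mf.
  by rewrite preimage_setT; apply => y _.
rewrite fubini_tonelli1//; first exact: measurable_comp_glue.
by move=> x; exact: f0.
Qed.

(** Tonelli with the first coordinate innermost, the order in which [a] is substituted at fixed
    [v]. *)
Lemma ge0_integral_glueC n (f : 'rV[R]_n.+1 -> \bar R) :
  measurable_fun setT f -> (forall y, 0 <= f y) ->
  \int[@lebesgue_rV R n.+1]_y f y =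
  \int[@lebesgue_rV R n]_v \int[mu]_a f (Defs.glue (a, v)).
Proof.
move=> mf f0; rewrite ge0_integral_glue//.
rewrite (fubini_tonelli (f \o @Defs.glue R n))//; first exact: measurable_comp_glue.
by move=> x; exact: f0.
Qed.

(** Lebesgue measure is [s] times its image under [x |-> s x]: both agree on half-open intervals,
    and uniqueness extends this to all measurable sets. *)
Lemma ge0_integral_scale (s : R) (f : R -> \bar R) : (0 < s)%R ->
  measurable_fun setT f -> (forall x, 0 <= f x) ->
  \int[mu]_x f (s * x)%R = (s^-1)%:E * \int[mu]_x f x.
Proof.
move=> s0 mf f0.
pose M (x : measurableTypeR R) : measurableTypeR R := (s * (x : R))%R.
have mM : measurable_fun setT M by exact: measurable_funM.
have [nu nuE] : exists nu : {measure set (measurableTypeR R) -> \bar R},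
    nu = pushforward mu M :> (set _ -> _).
  by unshelve eexists (pushforward mu M).
have munu A : measurable A -> mu A = mscale (NngNum (ltW s0)) nu A.
  apply: lebesgue_measure_unique => _ [[a b]] _ <-.
  rewrite [RHS](_ : _ = s%:E * nu `]a, b]%classic)// nuE /pushforward.
  have -> : M @^-1` `]a, b]%classic = `](a / s)%R, (b / s)%R]%classic.
    apply/seteqP; split => x /=; rewrite /M !in_itv/= ltr_pdivrMr// ler_pdivlMr//;
    by rewrite mulrC.
  rewrite !lebesgue_measure_itv/= !lte_fin ltr_pM2r ?invr_gt0//.
  case: ifPn => _; last by rewrite mule0.
  by rewrite -!EFinD -EFinM; congr EFin; field; rewrite gt_eqF.
have -> : \int[mu]_x f x = s%:E * \int[nu]_x f x.
  rewrite -(ge0_integral_mscale nu measurableT (NngNum (ltW s0)) mf)//.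
  by apply: eq_measure_integral => A mA _; exact: munu.
rewrite muleA -EFinM mulVf ?gt_eqF// mul1e nuE.
rewrite (ge0_integral_pushforward mM mu measurableT mf)//.
Qed.

(** By induction on the dimension, each coordinate contributing one factor [1 / s]. *)
Lemma ge0_integral_rV_scale n (s : R) (f : 'rV[R]_n -> \bar R) : (0 < s)%R ->
  measurable_fun setT f -> (forall x, 0 <= f x) ->
  \int[@lebesgue_rV R n]_v f (s *: v) = (s ^- n)%:E * \int[@lebesgue_rV R n]_v f v.
Proof.
move=> s0; elim: n f => [|n IH] f mf f0.
  rewrite invr1 mul1e; apply: eq_integral => v _; congr f.
  by apply/rowP => -[].
have mfs : measurable_fun setT (fun v : 'rV[R]_n.+1 => f (s *: v)).
  exact: (measurableT_comp mf (@measurable_scalerv R n.+1 s)).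
rewrite ge0_integral_glue// ge0_integral_glue//.
have mfg (a : R) : measurable_fun setT (fun v : 'rV[R]_n => f (Defs.glue (a, v))).
  by apply: (measurableT_comp (measurable_comp_glue mf)); exact: measurable_pair1.
pose F (a : R) := \int[@lebesgue_rV R n]_v f (Defs.glue (a, v)).
have mF : measurable_fun setT F.
  apply: (measurable_fun_fubini_tonelli_F (f \o @Defs.glue R n)).
    exact: measurable_comp_glue.
  by move=> x; exact: f0.
have F0 a : 0 <= F a by apply: integral_ge0 => v _; exact: f0.
have sn0 : 0 <= (s ^- n)%:E by rewrite lee_fin invr_ge0 exprn_ge0// ltW.
transitivity (\int[mu]_a ((s ^- n)%:E * F (s * a)%R)).
  apply: eq_integral => a _; rewrite /F -(IH _ (mfg (s * a)%R))//.
  by apply: eq_integral => v _; rewrite scale_glue.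
have mFs : measurable_fun setT (fun a : R => F (s * a)%R).
  by apply: (measurableT_comp mF); exact: measurable_funM.
transitivity ((s ^- n)%:E * \int[mu]_a F (s * a)%R).
  by apply: ge0_integralZl => // a _; exact: F0.
rewrite (ge0_integral_scale s0 mF F0) muleA -EFinM; congr (_%:E * _).
by rewrite exprSr invfM.
Qed.

End lebesgue_rV_integral.

Section euclidean_ball.
Context {R : realType}.
Notation mu := (@lebesgue_measure R).
Implicit Types n : nat.
Local Open Scope ereal_scope.

Lemma measurable_enorm_ball n (r : R) : measurable [set v : 'rV[R]_n | (enorm v < r)%R].
Proof.
rewrite (_ : mkset _ = @enorm R n @^-1` `]-oo, r[%classic).
  by rewrite -[X in measurable X]setTI; apply: measurable_enorm => //; exact: measurable_itv.
by apply/seteqP; split => v /=; rewrite in_itv.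
Qed.

Lemma lebesgue_rVS n (A : set 'rV[R]_n.+1) :
  @lebesgue_rV R n.+1 A = (mu \x @lebesgue_rV R n) (@Defs.glue R n @^-1` A).
Proof. by []. Qed.

(** The origin lies in the hyperplane where the first coordinate is 0, a product with a null
    factor. *)
Lemma lebesgue_rV_origin n : @lebesgue_rV R n.+1 [set 0%R] = 0.
Proof.
rewrite lebesgue_rVS; apply/eqP; rewrite -measure_le0.
apply: (@le_trans _ _ ((mu \x @lebesgue_rV R n) ([set 0%R] `*` setT))).
  have m1 : measurable ([set 0%R : R] `*` [set: 'rV[R]_n]) by exact: measurableX.
  apply: le_measure; rewrite ?inE//.
    rewrite -[X in measurable X]setTI; apply: measurable_glue => //.
    rewrite (_ : [set 0%R] = @enorm R n.+1 @^-1` [set 0%R]).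
      by rewrite -[X in measurable X]setTI; exact: measurable_enorm.
    by apply/seteqP; split => v /= /eqP v0; apply/eqP; rewrite ?enorm_eq0// -enorm_eq0.
  move=> [a v] /= av0; split => //.
  by rewrite -(coord_glue0 a v) av0 mxE.
rewrite product_measure1E// [X in X * _](_ : _ = 0) ?mul0e//.
exact: lebesgue_measure_set1.
Qed.

Let product_itv n (a b : R) (B : set 'rV[R]_n) : (a < b)%R -> measurable B ->
  (mu \x @lebesgue_rV R n) (`]a, b[%classic `*` B) =
  (b - a)%:E * @lebesgue_rV R n B.
Proof.
move=> ab mB; rewrite product_measure1E//; congr (_ * _).
by rewrite [LHS]lebesgue_measure_itv/= lte_fin ab -EFinB.
Qed.

(** The ball of radius [r] contains the product of [(- r / 2, r / 2)] with the ball of radius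
    [r / 2] in one dimension less. *)
Lemma lebesgue_ball_gt0 n (r : R) : (0 < r)%R ->
  0 < @lebesgue_rV R n [set v | (enorm v < r)%R].
Proof.
elim: n r => [|n IH] r r0.
  by rewrite /= diracE mem_set ?lte01//= /enorm /dotv big_ord0 sqrtr0.
have r20 : (0 < r / 2)%R by rewrite divr_gt0.
apply: (@lt_le_trans _ _ ((mu \x @lebesgue_rV R n)
    (`](- (r / 2))%R, (r / 2)%R[%classic `*` [set v | (enorm v < r / 2)%R]))).
  rewrite product_itv//; [|by lra|exact: measurable_enorm_ball].
  by rewrite mule_gt0 ?IH// lte_fin; lra.
rewrite lebesgue_rVS; apply: le_measure; rewrite ?inE//.
- by apply: measurableX => //; exact: measurable_enorm_ball.
- rewrite -[X in measurable X]setTI; apply: measurable_glue => //.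
  exact: measurable_enorm_ball.
move=> [a v] [] /=; rewrite in_itv/= => /andP[a1 a2] v1.
rewrite -(@ltr_pXn2r _ 2) ?nnegrE ?enorm_ge0 ?(ltW r0)// sqr_enorm dotv_glue -sqr_enorm.
have : (enorm v ^+ 2 <= (r / 2) ^+ 2)%R.
  by rewrite lerXn2r ?nnegrE ?enorm_ge0 ?(ltW r20)// ltW.
nra.
Qed.

(** The unit ball is contained in the product of [(-1, 1)] with the unit ball of one dimension
    less. *)
Lemma lebesgue_ball_lty n : @lebesgue_rV R n (@unit_ball R n) < +oo.
Proof.
elim: n => [|n IH].
  by rewrite /= diracE; case: (_ \in _) => //=; rewrite ?ltry.
apply: (@le_lt_trans _ _ ((mu \x @lebesgue_rV R n)
    (`](-1)%R, 1%R[%classic `*` @unit_ball R n))).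
  rewrite lebesgue_rVS; apply: le_measure; rewrite ?inE//.
  - rewrite -[X in measurable X]setTI; apply: measurable_glue => //.
    exact: measurable_enorm_ball.
  - by apply: measurableX => //; exact: measurable_enorm_ball.
  move=> [a v]; rewrite /unit_ball /= => av.
  have : (a ^+ 2 + enorm v ^+ 2 < 1)%R.
    by rewrite sqr_enorm -dotv_glue -sqr_enorm expr_lt1// enorm_ge0.
  have v0 := enorm_ge0 v; rewrite in_itv/= => H; clear IH; split.
    by apply/andP; split; nra.
  by rewrite ltNge; apply/negP => v1; nra.
rewrite product_itv//; [|exact: measurable_enorm_ball].
by rewrite lte_mul_pinfty// lee_fin opprK addr_ge0.
Qed.

(** The constant split off in cylindrical coordinates. It occurs also in the volume of the ball, so
    it cancels in averages over the sphere. *)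
Definition first_moment n : \bar R :=
  \int[@lebesgue_rV R n]_(v in @unit_ball R n) (enorm v)%:E.

Lemma first_moment_fin_num n : first_moment n \is a fin_num.
Proof.
rewrite ge0_fin_numE; last by apply: integral_ge0 => v _; rewrite lee_fin enorm_ge0.
apply: le_lt_trans (lebesgue_ball_lty n).
rewrite -[leRHS]mul1e -integral_cst; last exact: measurable_enorm_ball.
apply: ge0_le_integral => //; first exact: measurable_enorm_ball.
- by move=> v _; rewrite lee_fin enorm_ge0.
- by apply/measurable_EFinP; apply: measurable_funTS; exact: measurable_enorm.
- by move=> v; rewrite /unit_ball/= => /ltW v1; rewrite lee_fin.
Qed.

(** The exponent [n + 1] collects [n] from the volume and 1 from the integrand. *)
Lemma first_moment_scale n (c : R) : (0 < c)%R ->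
  \int[@lebesgue_rV R n]_(v in [set v | (enorm v < c)%R]) (enorm v)%:E =
  (c ^+ n.+1)%:E * first_moment n.
Proof.
move=> c0.
pose f (v : 'rV[R]_n) : \bar R := ((fun v => (enorm v)%:E) \_ (@unit_ball R n)) v.
have mf : measurable_fun setT f.
  apply/(measurable_restrictT _ _).1; first exact: measurable_enorm_ball.
  by apply/measurable_EFinP; apply: measurable_funTS; exact: measurable_enorm.
have f0 v : 0 <= f v by rewrite /f /patch; case: ifP; rewrite ?lee_fin ?enorm_ge0.
have ci : (0 < c^-1)%R by rewrite invr_gt0.
rewrite /first_moment [in RHS]integral_mkcond -/f.
have -> : \int[@lebesgue_rV R n]_v f v = (c ^- n)%:E * \int[@lebesgue_rV R n]_v f (c^-1 *: v).
  rewrite ge0_integral_rV_scale// muleA -EFinM exprVn invrK mulVf ?mul1e//.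
  by rewrite expf_neq0 ?gt_eqF.
rewrite muleA -EFinM exprS -mulrA divff ?expf_neq0 ?gt_eqF// mulr1.
rewrite integral_mkcond -ge0_integralZl//; last 2 first.
- exact: (measurableT_comp mf (@measurable_scalerv R n c^-1)).
- by rewrite lee_fin ltW.
apply: eq_integral => v _; rewrite /f /patch /unit_ball /=.
have <- : ((c^-1 *: v) \in [set v | (enorm v < 1)%R]) = (v \in [set v | (enorm v < c)%R]).
  apply/idP/idP; rewrite !inE/= enormZ ?(ltW ci)// mulrC ltr_pdivrMr// mul1r//.
case: ifP => _; last by rewrite mule0.
by rewrite -EFinM enormZ ?(ltW ci)// mulrA divff ?mul1r// gt_eqF.
Qed.

End euclidean_ball.

(** * Averages over the sphere *)

Section tan_substitution.
Context {R : realType}.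
Notation mu := (@lebesgue_measure R).
Implicit Types (c x t a : R).

Lemma is_derive_Mtan c x : cos x != 0 ->
  is_derive x 1 (fun x => c * tan x) (c * cos x ^- 2).
Proof.
move=> cx; have ? := is_derive_tan cx.
have -> : (fun x => c * tan x) = c *: tan :> (R -> R) by [].
by apply: is_derive_eq.
Qed.

Lemma continuous_derive_Mtan c x : 0 < cos x ->
  {for x, continuous (derive1 (fun x => c * tan x))}.
Proof.
move=> cx.
have near_cos : \forall y \near x, 0 < cos y.
  exact: (cvgr_gt (cos x) (@continuous_cos R x)).
have E : \forall y \near x, c * cos y ^- 2 = derive1 (fun x => c * tan x) y.
  near=> y; have cy : 0 < cos y by near: y.
  by rewrite derive1E; have [_ ->] := is_derive_Mtan c (lt0r_neq0 cy).
suff : derive1 (fun x => c * tan x) y @[y --> x] -->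
  derive1 (fun x => c * tan x) x by [].
have /= <- := nbhs_singleton E.
apply: cvg_trans; first exact: (near_eq_cvg E).
apply: cvgM; first exact: cvg_cst.
apply: cvgV; first by rewrite expf_neq0// gt_eqF.
exact: continuous_cosX.
Unshelve. all: by end_near. Qed.

(** With [a = cos t tan x] the argument of [F] becomes [sin x], the Jacobian is [cos t / cos ^ 2 x],
    and [x = t] corresponds to [a = sin t]. Geometrically, [a] runs along the chord of the unit ball
    at distance [cos t] from the first axis. *)
Lemma tan_substitution (F : R -> R) t : 0 < t < pi / 2 ->
  (forall u, -1 < u < 1 -> {for u, continuous F}) ->
  (\int[mu]_(a in `](- sin t)%R, (sin t)%R[)
     (F (a / Num.sqrt (a ^+ 2 + cos t ^+ 2)))%:E =
   \int[mu]_(x in `](- t)%R, t[) (F (sin x) * (cos t / cos x ^+ 2))%:E)%E.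
Proof.
move=> /andP[t0 tpi] cF.
have cos0 x : - t <= x <= t -> 0 < cos x.
  by move=> /andP[x1 x2]; apply: cos_gt0_pihalf; apply/andP; split; lra.
have ct : 0 < cos t by apply: cos0; apply/andP; split; lra.
have sqrt0 a : 0 < Num.sqrt (a ^+ 2 + cos t ^+ 2).
  by rewrite sqrtr_gt0 ltr_wpDl ?sqr_ge0 ?exprn_gt0.
pose G a := F (a / Num.sqrt (a ^+ 2 + cos t ^+ 2)).
have cG : continuous G.
  move=> a; have : {for a, continuous (F \o (fun a => a / Num.sqrt (a ^+ 2 + cos t ^+ 2)))}; last exact.
  apply: continuous_comp.
    apply: cvgM; first exact: cvg_id.
    apply: cvgV; first by rewrite gt_eqF.
    have : {for a, continuous (Num.sqrt \o (fun a => a ^+ 2 + cos t ^+ 2))}; last exact.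
    apply: continuous_comp; last exact: sqrt_continuous.
    by apply: cvgD; [exact: exprn_continuous|exact: cvg_cst].
  apply: cF; rewrite -ltr_norml normrM normfV (gtr0_norm (sqrt0 a)).
  rewrite ltr_pdivrMr// mul1r -sqrtr_sqr ltr_sqrt.
    by rewrite ltrDl exprn_gt0.
  by rewrite ltr_wpDl ?sqr_ge0 ?exprn_gt0.
pose M x := cos t * tan x.
have Mt : M t = sin t by rewrite /M /tan mulrC divfK ?gt_eqF.
have MNt : M (- t) = - sin t by rewrite /M tanN mulrN -/(M t) Mt.
have E x : - t <= x <= t -> (G \o M) x * derive1 M x = F (sin x) * (cos t / cos x ^+ 2).
  move=> /cos0 cx; rewrite derive1E; have [_ ->] := is_derive_Mtan (cos t) (lt0r_neq0 cx).
  congr (F _ * _); rewrite /M.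
  have -> : (cos t * tan x) ^+ 2 + cos t ^+ 2 = (cos t / cos x) ^+ 2.
    by rewrite expr_div_n exprMn cos2_tan2 ?gt_eqF//; ring.
  rewrite sqrtr_sqr gtr0_norm ?divr_gt0// /tan.
  by field; rewrite !gt_eqF.
have tt : - t <= t by lra.
have := @integration_by_substitution_increasing R M G (- t) t tt.
rewrite Mt MNt => H.
transitivity (\int[mu]_(a in `[(- sin t)%R, (sin t)%R]) (G a)%:E)%E.
  apply/esym/integral_itv_bndoo; apply/measurable_EFinP/measurable_funTS.
  exact: continuous_measurable_fun.
have It x : x \in `](- t), t[ -> 0 < cos x.
  by rewrite in_itv/= => /andP[x1 x2]; apply: cos0; rewrite !ltW.
rewrite H; first last.
- exact: continuous_subspaceT.
- split.
  + by move=> x /It cx; case: (is_derive_Mtan (cos t) (lt0r_neq0 cx)).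
  + apply: cvg_at_right_filter; have cx : 0 < cos (- t) by rewrite cosN.
    by apply: (is_derive_continuous (is_derive_Mtan (cos t) (lt0r_neq0 cx))).
  + apply: cvg_at_left_filter.
    by apply: (is_derive_continuous (is_derive_Mtan (cos t) (lt0r_neq0 ct))).
- apply/cvg_ex; eexists; apply: cvg_at_left_filter.
  exact: continuous_derive_Mtan.
- apply/cvg_ex; eexists; apply: cvg_at_right_filter.
  by apply: continuous_derive_Mtan; rewrite cosN.
- by move=> x /It; exact: continuous_derive_Mtan.
- move=> x y; rewrite !in_itv/= => /andP[x1 x2] /andP[y1 y2] xy.
  by rewrite /M ltr_pM2l// ltr_tan// in_itv/=; apply/andP; split; lra.
have EE : {in `[(- t)%R, t], (fun x => ((G \o M) * derive1 M) x) =1 (fun x => F (sin x) * (cos t / cos x ^+ 2))}.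
  by move=> x; rewrite in_itv/=; exact: E.
transitivity (\int[mu]_(x in `[(- t)%R, t]) (F (sin x) * (cos t / cos x ^+ 2))%:E)%E.
  by apply: eq_integral => x; rewrite inE/= => xI; rewrite EE.
apply: integral_itv_bndoo; apply/measurable_EFinP.
apply: open_continuous_measurable_fun; first exact: interval_open.
move=> x; rewrite inE/= => /[dup] /It cx; rewrite in_itv/= => /andP[x1 x2].
apply: cvgM.
  have : {for x, continuous (F \o sin)}; last exact.
  apply: continuous_comp; first exact: continuous_sin.
  apply: cF; rewrite -ltr_norml -(@ltr_pXn2r _ 2) ?nnegrE// real_normK ?num_real//.
  by rewrite expr1n sin2cos2 ltrBlDr ltrDl exprn_gt0.
apply: cvgM; first exact: cvg_cst.
apply: cvgV; first by rewrite expf_neq0// gt_eqF.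
exact: continuous_cosX.
Qed.

End tan_substitution.

Section polar_formula.
Context {R : realType}.
Notation mu := (@lebesgue_measure R).
Variables (n : nat) (f : 'rV[R]_n.+2 -> R) (F : R -> R).
Hypotheses (mf : measurable_fun setT f) (f0 : forall y, 0 <= f y).
Hypotheses (mF : measurable_fun setT F) (F0 : forall u, 0 <= F u).
Hypothesis cF : forall u, -1 < u < 1 -> {for u, continuous F}.
Hypothesis fF : forall y, enorm y = 1 -> f y = F (y ord0 ord0).

Let g : 'rV[R]_n.+2 -> \bar R :=
  (fun y => (f ((enorm y)^-1 *: y))%:E) \_ (@unit_ball R n.+2).

(** What [g] becomes after the substitution, Jacobian included; the cutoff expresses the unit ball
    in the variables [(x, v)]. *)
Let h (z : measurableTypeR R * 'rV[R]_n.+1) : \bar R :=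
  if (`|z.1 : R| < pi / 2) && (enorm z.2 < cos (z.1 : R))
  then (F (sin (z.1 : R)) * (enorm z.2 / cos (z.1 : R) ^+ 2))%:E else 0%E.

Let measurable_g : measurable_fun setT g.
Proof.
apply/(measurable_restrictT _ _).1; first exact: measurable_enorm_ball.
apply/measurable_EFinP/measurable_funTS/(measurableT_comp mf).
apply: measurable_fun_rV => i.
rewrite (_ : (fun _ => _) = (fun y => enorm y `^ (-1) * coord_rV i y)).
  apply: measurable_funM; last exact: measurable_coord.
  by apply: (measurableT_comp (measurable_powR _)); exact: measurable_enorm.
by apply/funext => y; rewrite mxE powR_inv1 ?enorm_ge0.
Qed.

Let g0 y : (0 <= g y)%E.
Proof. by rewrite /g /patch; case: ifP => //; rewrite lee_fin. Qed.

Let h0 z : (0 <= h z)%E.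
Proof.
rewrite /h; case: ifP => // _.
by rewrite lee_fin mulr_ge0// divr_ge0 ?enorm_ge0 ?sqr_ge0.
Qed.

Let measurable_h : measurable_fun setT h.
Proof.
have mfst : measurable_fun setT (fun z : measurableTypeR R * 'rV[R]_n.+1 => z.1 : R).
  exact: measurable_fst.
have mn : measurable_fun setT (fun z : measurableTypeR R * 'rV[R]_n.+1 => enorm z.2).
  by apply: (measurableT_comp (@measurable_enorm R n.+1)); exact: measurable_snd.
have mcos : measurable_fun setT (fun z : measurableTypeR R * 'rV[R]_n.+1 => cos (z.1 : R)).
  by apply: measurableT_comp mfst; apply: continuous_measurable_fun; exact: continuous_cos.
have msin : measurable_fun setT (fun z : measurableTypeR R * 'rV[R]_n.+1 => sin (z.1 : R)).
  by apply: measurableT_comp mfst; apply: continuous_measurable_fun; exact: continuous_sin.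
apply: measurable_fun_ifT => //.
  apply: measurable_and; apply: measurable_fun_ltr => //.
  by apply: measurableT_comp mfst; exact: normr_measurable.
apply/measurable_EFinP; apply: measurable_funM; first exact: (measurableT_comp mF).
rewrite (_ : (fun _ => _) = (fun z : measurableTypeR R * 'rV[R]_n.+1 =>
   enorm z.2 * (cos (z.1 : R) ^+ 2) `^ (-1))).
  apply: measurable_funM => //; apply: (measurableT_comp (measurable_powR _)).
  exact: measurable_funX.
by apply/funext => z; rewrite powR_inv1 ?sqr_ge0.
Qed.

Let inner (v : 'rV[R]_n.+1) : v != 0 ->
  (\int[mu]_a g (Defs.glue (a, v)) = \int[mu]_x h (x, v))%E.
Proof.
move=> v0; have e0 : 0 < enorm v by rewrite lt_neqAle enorm_ge0 eq_sym enorm_eq0 v0.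
(* When [|v| >= 1] the line through [v] parallel to the first axis misses the open ball and both
   sides vanish. *)
have [e1|e1] := leP 1 (enorm v).
  transitivity (\int[mu]_(a in [set: R]) (cst 0%E : R -> \bar R) a)%E.
    apply: eq_integral => a _; rewrite /g patchE memNset//.
    rewrite /unit_ball/=; apply/negP; rewrite -leNgt -(@ler_pXn2r _ 2) ?nnegrE ?enorm_ge0//.
    rewrite sqr_enorm dotv_glue -sqr_enorm expr1n.
    rewrite (@le_trans _ _ (enorm v ^+ 2)) ?lerDr ?sqr_ge0//.
    by rewrite -(expr1n _ 2) lerXn2r ?nnegrE ?enorm_ge0.
  apply: eq_integral => x _; rewrite /h/= ifF//; apply/negP => /andP[_].
  by apply/negP; rewrite -leNgt (le_trans (cos_le1 _)).
have rho : -1 <= enorm v <= 1 by apply/andP; split; lra.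
(* The latitude at which that line leaves the ball. *)
pose t : R := acos (enorm v).
have ct : cos t = enorm v by rewrite acosK// in_itv.
have t0 : 0 < t by apply: acos_gt0; apply/andP; split; lra.
have tpi : t <= pi by exact: acos_lepi.
have pi0 := pi_gt0 R.
have t2 : t < pi / 2.
  rewrite -ltr_cos ?in_itv/=; first by rewrite ct cos_pihalf.
    by apply/andP; split; lra.
  by apply/andP; split; lra.
have st : 0 < sin t by apply: sin_gt0_pi; apply/andP; split; lra.
have tI : 0 < t < pi / 2 by rewrite t0.
transitivity (\int[mu]_(a in `](- sin t)%R, (sin t)%R[)
     (F (a / Num.sqrt (a ^+ 2 + cos t ^+ 2)))%:E)%E.
  rewrite [RHS]integral_mkcond; apply: eq_integral => a _; rewrite /g !patchE.
  have -> : (Defs.glue (a, v) \in @unit_ball R n.+2) = (a \in `](- sin t), (sin t)[%classic).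
    have key : (enorm (Defs.glue (a, v)) < 1) = (`|a| < sin t).
      rewrite -[LHS](@ltr_pXn2r _ 2) ?nnegrE ?enorm_ge0//.
      rewrite -[RHS](@ltr_pXn2r _ 2) ?nnegrE ?(ltW st)//.
      rewrite sqr_enorm dotv_glue -sqr_enorm -ct expr1n real_normK ?num_real//.
      by rewrite sin2cos2 ltrBrDr.
    by apply/idP/idP; rewrite !inE /unit_ball/= in_itv/= -ltr_norml key.
  case: ifP => // _; congr EFin.
  have gE : enorm (Defs.glue (a, v)) = Num.sqrt (a ^+ 2 + cos t ^+ 2).
    by rewrite /enorm dotv_glue -sqr_enorm ct.
  have gN : Num.sqrt (a ^+ 2 + cos t ^+ 2) != 0.
    by rewrite sqrtr_eq0 -ltNge ltr_wpDl ?sqr_ge0 ?exprn_gt0// ct.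
  rewrite fF; first by rewrite gE mxE coord_glue0 mulrC.
  by rewrite enormZ ?invr_ge0 ?enorm_ge0// gE mulVf.
rewrite (tan_substitution tI cF) integral_mkcond; apply: eq_integral => x _.
rewrite /h patchE /=.
have -> : (x \in `](- t), t[%classic) = (`|x| < pi / 2) && (enorm v < cos x).
  apply/idP/idP; rewrite inE/= in_itv/= -ltr_norml.
    move=> xt; have x2 : `|x| < pi / 2 by apply: lt_trans t2.
    rewrite x2/= -ct -[cos x]cos_norm ltr_cos// in_itv/=;
      by apply/andP; split; have := normr_ge0 x; lra.
  move=> /andP[x2]; rewrite -ct -[cos x]cos_norm ltr_cos// in_itv/=;
    by apply/andP; split; have := normr_ge0 x; lra.
by case: ifP => // _; rewrite ct.
Qed.

(* In cylindrical coordinates [y = (a, v)], substitute [a = |v| tan x]: then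
   [y_1 / |y| = sin x] and [|y| < 1] becomes [|v| < cos x]. *)
Lemma polar_formula :
  (\int[@lebesgue_rV R n.+2]_(y in @unit_ball R n.+2) (f ((enorm y)^-1 *: y))%:E =
   @first_moment R n.+1 *
   \int[mu]_(x in `[(- (pi / 2))%R, (pi / 2)%R]) (F (sin x) * cos x ^+ n)%:E)%E.
Proof.
rewrite integral_mkcond ge0_integral_glueC//.
transitivity (\int[@lebesgue_rV R n.+1]_v \int[mu]_x h (x, v))%E.
  apply: ge0_ae_eq_integral => //.
  - apply: (measurable_fun_fubini_tonelli_G (g \o @Defs.glue R n.+1)).
      exact: (measurableT_comp measurable_g (@measurable_glue R n.+1)).
    by move=> z; exact: g0.
  - exact: (measurable_fun_fubini_tonelli_G h).
  - by move=> v _; apply: integral_ge0 => a _; exact: g0.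
  - by move=> v _; apply: integral_ge0 => x _; exact: h0.
  (* The substitution degenerates on the axis [v = 0], which is a null set. *)
  - exists [set 0]; split.
    + rewrite (_ : [set 0] = @enorm R n.+1 @^-1` [set 0]).
        by rewrite -[X in measurable X]setTI; exact: measurable_enorm.
      by apply/seteqP; split => v /= /eqP v0; apply/eqP; rewrite ?enorm_eq0// -enorm_eq0.
    + exact: lebesgue_rV_origin.
    + by move=> v /= /not_implyP[_] H; apply: contrapT => /eqP v0; apply: H; exact: inner.
rewrite -(fubini_tonelli h)//.
have mFs : measurable_fun setT (fun x : R => (F (sin x) * cos x ^+ n)%:E).
  apply/measurable_EFinP/measurable_funM.
    by apply: (measurableT_comp mF); apply: continuous_measurable_fun; exact: continuous_sin.
  by apply: continuous_measurable_fun; exact: continuous_cosX.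
rewrite integral_itv_bndoo; last exact: measurable_funTS.
have K0 : (0 <= @first_moment R n.+1)%E.
  by apply: integral_ge0 => v _; rewrite lee_fin enorm_ge0.
transitivity (\int[mu]_(x in `](- (pi / 2))%R, (pi / 2)%R[)
    (@first_moment R n.+1 * (F (sin x) * cos x ^+ n)%:E))%E; last first.
  apply: ge0_integralZl => //; first exact: measurable_funTS.
  move=> x; rewrite /= in_itv/= => xI.
  by rewrite lee_fin mulr_ge0// exprn_ge0// ltW// cos_gt0_pihalf.
rewrite [RHS]integral_mkcond; apply: eq_integral => x _.
rewrite patchE; case: ifPn => [|xI]; last first.
  transitivity (\int[@lebesgue_rV R n.+1]_(v in setT) cst 0%E v)%E; last exact: integral0.
  apply: eq_integral => v _; rewrite /h/= ifF//; move: xI; apply: contraNF => /andP[xI _].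
  by rewrite inE/= in_itv/= -ltr_norml.
rewrite inE/= in_itv/= => xI; have cx := cos_gt0_pihalf xI.
have cK : (0 <= (F (sin x) / cos x ^+ 2)%:E)%E.
  by rewrite lee_fin divr_ge0// sqr_ge0.
transitivity ((F (sin x) / cos x ^+ 2)%:E *
    \int[@lebesgue_rV R n.+1]_(v in [set v | (enorm v < cos x)%R]) (enorm v)%:E)%E.
  rewrite -ge0_integralZl//; last 3 first.
  - exact: measurable_enorm_ball.
  - by apply/measurable_EFinP; apply: measurable_funTS; exact: measurable_enorm.
  - by move=> v _; rewrite lee_fin enorm_ge0.
  rewrite [RHS]integral_mkcond.
  rewrite -[LHS]/(\int[@lebesgue_rV R n.+1]_v h (x, v))%E.
  apply: eq_integral => v _; rewrite /h patchE/= ltr_norml xI/=.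
  have -> : (v \in [set v | enorm v < cos x]) = (enorm v < cos x).
    by apply/idP/idP; rewrite inE.
  by case: ifP => // _; rewrite -EFinM; congr EFin; rewrite mulrA mulrAC.
(* The slice [|v| < cos x] contributes [cos x ^+ n.+2]; the Jacobian takes away [cos x ^+ 2] and
   leaves the weight [cos x ^+ n]. *)
rewrite first_moment_scale// muleA muleC -EFinM; congr (_ * _%:E)%E.
by rewrite !exprS expr0; field; rewrite gt_eqF.
Qed.

End polar_formula.

Section sphere_average.
Context {R : realType}.
Notation mu := (@lebesgue_measure R).
Variables (n : nat).

Let C : R := \int[mu]_(x in `[- (pi / 2), pi / 2]) (cos x ^+ n).

Let CE : (\int[mu]_(x in `[(- (pi / 2))%R, (pi / 2)%R]) (cos x ^+ n)%:E = C%:E)%E.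
Proof.
rewrite /C /Rintegral fineK//.
have := @continuous_integrable_segment R _ (- (pi / 2)) (pi / 2) (@continuous_cosX R n).
exact: integrable_fin_num.
Qed.

Lemma unit_ball_volume :
  @lebesgue_rV R n.+2 (@unit_ball R n.+2) = (@first_moment R n.+1 * C%:E)%E.
Proof.
rewrite -CE; transitivity (\int[@lebesgue_rV R n.+2]_(y in @unit_ball R n.+2) 1%:E)%E.
  by rewrite integral_cst ?mul1e//; exact: measurable_enorm_ball.
rewrite (@polar_formula R n (fun=> 1) (fun=> 1))//.
  by congr (_ * _)%E; apply: eq_integral => x _; rewrite mul1r.
by move=> u _; exact: cvg_cst.
Qed.

(** Read off from the volume of the unit ball, which is positive and a positive multiple of the
    moment. *)
Lemma first_moment_gt0 : (0 < fine (@first_moment R n.+1))%R.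
Proof.
have := @lebesgue_ball_gt0 R n.+2 1 ltr01.
rewrite -/(@unit_ball R n.+2) unit_ball_volume -(fineK (@first_moment_fin_num R n.+1)).
by rewrite -EFinM lte_fin pmulr_lgt0// integral_cosX_gt0.
Qed.

(** The polar formula is applied to the positive and negative parts, whose difference makes sense by
    integrability; dividing by the volume of the ball cancels the first moment. *)
Lemma sphere_meanE (f : 'rV[R]_n.+2 -> R) (F : R -> R) :
  measurable_fun setT f -> measurable_fun setT F ->
  (forall u, -1 < u < 1 -> {for u, continuous F}) ->
  (forall y, enorm y = 1 -> f y = F (y ord0 ord0)) ->
  mu.-integrable `[- (pi / 2), pi / 2] (EFin \o (fun x => F (sin x) * cos x ^+ n)) ->
  sphere_mean f =
  (\int[mu]_(x in `[- (pi / 2), pi / 2]) (F (sin x) * cos x ^+ n)) / C.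
Proof.
move=> mf mF cF fF iF.
have K0 := first_moment_gt0; set k := fine (@first_moment R n.+1) in K0.
have C0 : 0 < C by exact: integral_cosX_gt0.
rewrite /sphere_mean unit_ball_volume -(fineK (@first_moment_fin_num R n.+1)) -/k.
rewrite -EFinM /= {1}/Rintegral.
have cmax (G : R -> R) u : {for u, continuous G} ->
    {for u, continuous (fun u => Num.max (G u) 0)}.
  by move=> cG; apply: continuous_max => //; exact: cvg_cst.
have mpos := @polar_formula R n (fun y => Num.max (f y) 0) (fun u => Num.max (F u) 0).
have mneg := @polar_formula R n (fun y => Num.max (- f y) 0) (fun u => Num.max (- F u) 0).
have c0 x : x \in `[(- (pi / 2)), (pi / 2)] -> 0 <= cos x ^+ n.
  by rewrite in_itv/= => xI; rewrite exprn_ge0// cos_ge0_pihalf.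
have posE : (\int[mu]_(x in `[(- (pi / 2))%R, (pi / 2)%R]) (Num.max (F (sin x)) 0 * cos x ^+ n)%:E =
   \int[mu]_(x in `[(- (pi / 2))%R, (pi / 2)%R]) ((fun x => (F (sin x) * cos x ^+ n)%:E)^\+ x))%E.
  apply: eq_integral => x; rewrite inE/= => /c0 cx.
  by rewrite funeposE maxr_pMl// mul0r EFin_max.
have negE : (\int[mu]_(x in `[(- (pi / 2))%R, (pi / 2)%R]) (Num.max (- F (sin x)) 0 * cos x ^+ n)%:E =
   \int[mu]_(x in `[(- (pi / 2))%R, (pi / 2)%R]) ((fun x => (F (sin x) * cos x ^+ n)%:E)^\- x))%E.
  apply: eq_integral => x; rewrite inE/= => /c0 cx.
  by rewrite funenegE maxr_pMl// mul0r mulNr EFin_max EFinN.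
have H : (\int[@lebesgue_rV R n.+2]_(y in @unit_ball R n.+2) (f ((enorm y)^-1 *: y))%:E =
   k%:E * \int[mu]_(x in `[(- (pi / 2))%R, (pi / 2)%R]) (F (sin x) * cos x ^+ n)%:E)%E.
  rewrite integralE [in RHS]integralE muleBr//; last first.
    exact: integrable_add_def iF.
  rewrite -posE -negE /k fineK; last exact: first_moment_fin_num.
  rewrite -mpos; last 6 first.
  - exact: measurable_maxr.
  - by move=> y; rewrite le_max lexx orbT.
  - exact: measurable_maxr.
  - by move=> y; rewrite le_max lexx orbT.
  - by move=> u /cF; exact: cmax.
  - by move=> y /fF ->.
  rewrite -mneg; last 6 first.
  - by apply: measurable_maxr => //; exact: measurable_funN.
  - by move=> y; rewrite le_max lexx orbT.
  - by apply: measurable_maxr => //; exact: measurable_funN.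
  - by move=> y; rewrite le_max lexx orbT.
  - move=> u /cF c; have /cmax : {for u, continuous (fun u => - F u)} by exact: continuousN.
    exact.
  - by move=> y /fF ->.
  congr (_ - _)%E; apply: eq_integral => y _.
    by rewrite funeposE EFin_max.
  by rewrite funenegE EFin_max EFinN.
rewrite H fineM//; last first.
  exact: (integrable_fin_num _ iF).
rewrite -/(Rintegral _ _ _) /=; move: (Rintegral _ _ _) => I.
by field; rewrite !gt_eqF.
Qed.

End sphere_average.

(** * The kernel [phi] as a normalized flux *)

Section phi.
Context {R : realType}.
Notation mu := (@lebesgue_measure R).
Variables (n : nat) (alpha : R).
Hypotheses (n0 : (0 < n)%N) (alpha2 : alpha < 2) (alphan : 2 - alpha <= n%:R).

Let b : R := (2 - alpha) / 2.

Let b0 : 0 < b. Proof. by rewrite divr_gt0// subr_gt0. Qed.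

Let bn : 2 * b <= n%:R. Proof. by rewrite /b mulrC divfK. Qed.

Let integrand r : R -> R := fun x => (r - sin x) * sqdist r x `^ (- b) * cos x ^+ n.

Let integrandE r : integrand r =
  (fun x => r * (sqdist r x `^ (- b) * cos x ^+ n) -
            sqdist r x `^ (- b) * (sin x * cos x ^+ n)).
Proof. by apply/funext => x; rewrite /integrand; ring. Qed.

Let icos r : mu.-integrable `[- (pi / 2), pi / 2]
  (EFin \o (fun x => sqdist r x `^ (- b) * cos x ^+ n)).
Proof.
apply: (integrable_sqdist_bounded n0 (ltW b0) bn); first exact: continuous_cosX.
by move=> x; rewrite normrX.
Qed.

Let isin r : mu.-integrable `[- (pi / 2), pi / 2]
  (EFin \o (fun x => sqdist r x `^ (- b) * (sin x * cos x ^+ n))).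
Proof.
apply: (integrable_sqdist_bounded n0 (ltW b0) bn); first exact: continuous_sincosX.
exact: sincosX_le.
Qed.

Let ircos r : mu.-integrable `[- (pi / 2), pi / 2]
  (EFin \o (fun x => r * (sqdist r x `^ (- b) * cos x ^+ n))).
Proof.
by apply: (integrableZl _ r (icos r)).
Qed.

Let flux_integrable r : mu.-integrable `[- (pi / 2), pi / 2] (EFin \o integrand r).
Proof.
rewrite integrandE.
by apply: (integrableB _ (ircos r) (isin r)).
Qed.

(** Here [r = 1] is included, unlike in [fluxE]: both parts of the integrand are integrable for
    every [r]. *)
Let fluxE_all r : flux n b r = \int[mu]_(x in `[- (pi / 2), pi / 2]) integrand r x.
Proof.
rewrite /flux /potential /sqdist_int integrandE RintegralB//.
by rewrite RintegralZl.
Qed.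

(** On the unit sphere [|r e_1 - y| ^ 2 = r ^ 2 - 2 r y_1 + 1], so the averaged function depends on
    [y_1 = sin x] only, and raising this square to the power [b] gives
    [|r e_1 - y| ^ (2 - alpha)]. *)
Lemma phiE r : 0 < r ->
  @phi R n.+2 alpha r =
  flux n b r / \int[mu]_(x in `[- (pi / 2), pi / 2]) (cos x ^+ n).
Proof.
move=> r0; rewrite fluxE_all /phi.
pose F u : R := (r - u) * (r ^+ 2 - 2 * r * u + 1) `^ (- b).
have FE : (fun x => F (sin x) * cos x ^+ n) = integrand r.
  by apply/funext => x; rewrite /F -sqdistE.
rewrite (@sphere_meanE R n _ F).
- by rewrite FE.
- have mdot : measurable_fun setT (fun y : 'rV[R]_n.+2 => dotv y (e1 R n.+2)).
    apply: measurable_sum => i; apply: measurable_funM => //.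
    exact: measurable_coord.
  apply: measurable_funM; first exact: measurable_funB.
  rewrite (_ : (fun _ => _) = (fun y : 'rV[R]_n.+2 => enorm (r *: e1 R n.+2 - y) `^ (- (2 - alpha)))).
    apply: (measurableT_comp (measurable_powR _)).
    apply: (measurableT_comp (@measurable_enorm R n.+2)).
    apply: measurable_fun_rV => i.
    rewrite (_ : (fun _ => _) = (fun y => (r *: e1 R n.+2) ord0 i - coord_rV i y)).
      by apply: measurable_funB => //; exact: measurable_coord.
    by apply/funext => y; rewrite !mxE.
  by apply/funext => y; rewrite powRN.
- apply: measurable_funM; first exact: measurable_funB.
  apply: (measurableT_comp (measurable_powR _)).
  apply: measurable_funD => //; apply: measurable_funB => //.
- move=> u /andP[u1 u2]; apply: cvgM.
    by apply: cvgB; [exact: cvg_cst|exact: cvg_id].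
  have : {for u, continuous ((@powR R ^~ (- b)) \o (fun u => r ^+ 2 - 2 * r * u + 1))}; last exact.
  apply: continuous_comp.
    apply: cvgD; last exact: cvg_cst.
    apply: cvgB; first exact: cvg_cst.
    by apply: cvgM; [exact: cvg_cst|exact: cvg_id].
  apply/differentiable_continuous/derivable1_diffP/derivable_powR.
  rewrite in_itv/= andbT.
  (* In this form positivity for [|u| < 1] is visible for every [r], including [r = 1]. *)
  have -> : r ^+ 2 - 2 * r * u + 1 = (r - u) ^+ 2 + (1 - u) * (1 + u) by ring.
  by rewrite ltr_wpDl ?sqr_ge0// mulr_gt0//; lra.
- move=> y y1.
  have dotE (i : 'I_n.+2) : e1 R n.+2 ord0 i = (i == ord0)%:R.
    by rewrite mxE.
  have ye : dotv y (e1 R n.+2) = y ord0 ord0.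
    rewrite /dotv (bigD1 ord0)//= dotE eqxx mulr1 big1 ?addr0// => i i0.
    by rewrite dotE (negbTE i0) mulr0.
  have D : dotv (r *: e1 R n.+2 - y) (r *: e1 R n.+2 - y) = r ^+ 2 - 2 * r * y ord0 ord0 + 1.
    have -> : dotv (r *: e1 R n.+2 - y) (r *: e1 R n.+2 - y) =
      r ^+ 2 * dotv (e1 R n.+2) (e1 R n.+2) - 2 * r * dotv y (e1 R n.+2) + dotv y y.
      rewrite /dotv !mulr_sumr -sumrB -big_split/=; apply: eq_bigr => i _.
      by rewrite !mxE; ring.
    rewrite -[dotv y y]sqr_enorm y1 expr1n ye.
    rewrite /dotv (bigD1 ord0)//= dotE eqxx mulr1 big1 ?addr0 ?mulr1// => i i0.
    by rewrite dotE (negbTE i0) mulr0.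
  rewrite ye /F; congr (_ * _).
  rewrite powRN; congr (_^-1).
  rewrite -D -sqr_enorm -powR_mulrn ?enorm_ge0// -powRrM; congr (_ `^ _).
  by rewrite /b mulrC divfK.
- by rewrite FE.
Qed.

Lemma phi_div_nonincreasing p q : 0 < p -> p <= q ->
  @phi R n.+2 alpha q / q <= @phi R n.+2 alpha p / p.
Proof.
move=> p0 pq; have q0 : 0 < q by exact: lt_le_trans pq.
rewrite (phiE q0) (phiE p0).
have := @integral_cosX_gt0 R n; move: (Rintegral _ _ _) => C C0.
have := flux_div_nonincreasing n0 b0 bn p0 pq.
move: (flux n b q) (flux n b p) => A B.
by rewrite ![_ / C / _]mulrAC ler_pM2r ?invr_gt0.
Qed.

Lemma phi_div_decreasing p q : 0 < p -> p < q -> 1 < q ->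
  @phi R n.+2 alpha q / q < @phi R n.+2 alpha p / p.
Proof.
move=> p0 pq q1; have q0 : 0 < q by exact: lt_trans pq.
rewrite (phiE q0) (phiE p0).
have := @integral_cosX_gt0 R n; move: (Rintegral _ _ _) => C C0.
have := flux_div_decreasing n0 b0 bn p0 pq q1.
move: (flux n b q) (flux n b p) => A B.
by rewrite ![_ / C / _]mulrAC ltr_pM2r ?invr_gt0.
Qed.

End phi.

(** * The support of a measure *)

Section msupport.
Context {R : realType} {d : nat}.
Implicit Types (x y z : 'rV[R]_d).

Lemma enorm_lt_add x y (s : R) : 0 < enorm x -> enorm x < s ->
  enorm (y - x) < s - enorm x -> enorm y < s.
Proof.
move=> x0 xs yx; set r := enorm x in x0 xs yx.
have sr : 0 < s - r by rewrite subr_gt0.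
have s0 : 0 < s by exact: lt_trans xs.
rewrite -(@ltr_pXn2r _ 2) ?nnegrE ?enorm_ge0 ?(ltW s0)// sqr_enorm.
(* Convexity of the square with weights [r / s] and [(s - r) / s], summed over coordinates; this
   yields the triangle inequality. *)
have H : dotv y y <= s / r * dotv x x + s / (s - r) * dotv (y - x) (y - x).
  rewrite /dotv !mulr_sumr -big_split/=; apply: ler_sum => i _; rewrite !mxE.
  move: (y ord0 i) (x ord0 i) => b a; rewrite -subr_ge0.
  have -> : s / r * (a * a) + s / (s - r) * ((b - a) * (b - a)) - b * b =
      (s * a - r * b) ^+ 2 / (r * (s - r)).
    by field; rewrite !gt_eqF.
  by rewrite divr_ge0 ?sqr_ge0// mulr_ge0 ?ltW.
apply: (le_lt_trans H); rewrite -!sqr_enorm -/r.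
have -> : s ^+ 2 = s / r * r ^+ 2 + s / (s - r) * (s - r) ^+ 2.
  by field; rewrite !gt_eqF.
rewrite ltrD2l ltr_pM2l ?divr_gt0// ltr_pXn2r ?nnegrE ?enorm_ge0 ?(ltW sr)//.
Qed.

Lemma enorm_ball_double x y z (r : R) : 0 < r -> enorm (y - x) < r ->
  enorm (z - x) < r -> enorm (z - y) < 2 * r.
Proof.
move=> r0 yr zr; have r20 : 0 < 2 * r by rewrite mulr_gt0.
rewrite -(@ltr_pXn2r _ 2) ?nnegrE ?enorm_ge0 ?(ltW r20)// sqr_enorm.
have H : dotv (z - y) (z - y) <= 2 * dotv (z - x) (z - x) + 2 * dotv (y - x) (y - x).
  rewrite /dotv !mulr_sumr -big_split/=; apply: ler_sum => i _; rewrite !mxE.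
  by have := sqr_ge0 ((z ord0 i - x ord0 i) + (y ord0 i - x ord0 i)); lra.
apply: (le_lt_trans H); rewrite -!sqr_enorm.
have sq a : 0 <= a -> a < r -> a ^+ 2 < r ^+ 2 :> R.
  by move=> a0 ar; rewrite ltr_pXn2r ?nnegrE ?(ltW r0).
have := sq _ (enorm_ge0 _) yr; have := sq _ (enorm_ge0 _) zr.
by rewrite exprMn; lra.
Qed.

Lemma rational_approx y (r : R) : 0 < r ->
  exists q : 'rV[rat]_d, enorm (y - map_mx ratr q) < r.
Proof.
move=> r0; pose e : R := r / d.+1%:R.
have e0 : 0 < e by rewrite divr_gt0.
have /choice[q qP] (i : 'I_d) : exists q : rat, `|y ord0 i - ratr q| < e.
  have : y ord0 i - e < y ord0 i + e by lra.
  by move=> /rat_in_itvoo[q]; rewrite in_itv/= => /andP[q1 q2]; exists q;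
    rewrite ltr_norml; apply/andP; split; lra.
exists (\row_i q i).
rewrite -(@ltr_pXn2r _ 2) ?nnegrE ?enorm_ge0 ?(ltW r0)// sqr_enorm.
apply: (@le_lt_trans _ _ (\sum_(i < d) e ^+ 2)).
  apply: ler_sum => i _; rewrite !mxE -expr2 -real_normK ?num_real//.
  by rewrite lerXn2r ?nnegrE ?(ltW e0)// ltW.
rewrite sumr_const card_ord -mulr_natl /e expr_div_n mulrCA gtr_pMr ?exprn_gt0//.
rewrite ltr_pdivrMr ?exprn_gt0// mul1r -natrX ltr_nat.
by rewrite expnS expn1 leq_pmulr.
Qed.

Lemma measurable_ball_center x (r : R) :
  measurable [set z : 'rV[R]_d | enorm (z - x) < r].
Proof.
rewrite (_ : mkset _ = (fun z => z - x) @^-1` [set z | enorm z < r])//.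
rewrite -[X in measurable X]setTI.
have m : measurable_fun setT (fun z : 'rV[R]_d => z - x).
  apply: measurable_fun_rV => i.
  rewrite (_ : (fun _ => _) = (fun z => coord_rV i z - x ord0 i)).
    by apply: measurable_funB => //; exact: measurable_coord.
  by apply/funext => z; rewrite !mxE.
by apply: m => //; exact: measurable_enorm_ball.
Qed.

(* Lindelof: the complement of the support is covered by the null balls with
   rational centre and radius [1 / k.+1]. *)
Lemma negligible_msupportC (mu : probability 'rV[R]_d R) :
  mu.-negligible (~` msupport mu).
Proof.
pose B (c : 'rV[rat]_d * nat) : set 'rV[R]_d :=
  [set z | enorm (z - map_mx ratr c.1) < c.2.+1%:R^-1].
pose N (j : nat) : set 'rV[R]_d :=
  if unpickle j is Some c then if mu (B c) == 0%E then B c else set0 else set0.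
apply: (negligibleS (A := \bigcup_j N j)); last first.
  apply: negligible_bigcup => j; rewrite /N.
  case: unpickle => [c|]; last exact: negligible_set0.
  case: eqP => [Bc|_]; last exact: negligible_set0.
  by exists (B c); split => //; exact: measurable_ball_center.
move=> y /= /existsNP[e /not_implyP[e0 /negP]]; rewrite -leNgt measure_le0 => ye.
have e20 : 0 < e / 2 by rewrite divr_gt0.
have [k _ /(_ k (leqnn _))/= ke] := near_infty_natSinv_lt (PosNum e20).
have {}ke : k.+1%:R^-1 < e / 2 by exact: ke.
have k0 : 0 < k.+1%:R^-1 :> R by rewrite invr_gt0.
have [q qy] := rational_approx y k0.
(* The rational ball contains [y] and its radius is below [e / 2], so it stays inside the null ball
   of radius [e] about [y]. *)
have sub : B (q, k) `<=` [set z | enorm (z - y) < e].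
  move=> z /= zq; have := enorm_ball_double k0 qy zq => /lt_le_trans; apply.
  by rewrite mulrC -ler_pdivlMr// ltW.
exists (pickle (q, k)) => //; rewrite /N pickleK ifT//.
rewrite -measure_le0 -(eqP ye) le_measure ?inE//; exact: measurable_ball_center.
Qed.

End msupport.

(** * Similarity solutions *)

(** The difference [f - g] is nonnegative with zero integral, hence vanishes almost everywhere,
    while it is positive on [A]. *)
Lemma le_Rintegral_eq_null d (T : measurableType d) (R : realType)
    (nu : {measure set T -> \bar R}) (D A : set T) (f g : T -> R) :
  measurable D -> measurable A -> A `<=` D ->
  nu.-integrable D (EFin \o f) -> nu.-integrable D (EFin \o g) ->
  (forall x, D x -> g x <= f x) -> (forall x, A x -> g x < f x) ->
  \int[nu]_(x in D) f x = \int[nu]_(x in D) g x -> nu A = 0%E.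
Proof.
move=> mD mA AD fi gi gf ltgf fgE.
have hi : nu.-integrable D (EFin \o (f \- g)).
  by apply: (integrableB mD fi gi).
have int0 : (\int[nu]_(x in D) `|((f \- g) x)%:E| = 0)%E.
  transitivity (\int[nu]_(x in D) ((f \- g) x)%:E)%E.
    by apply: eq_integral => x /set_mem Dx; rewrite gee0_abs// lee_fin subr_ge0 gf.
  have /fineK <- := integrable_fin_num mD hi.
  by rewrite -/(Rintegral _ _ _) RintegralB// fgE subrr.
have /integrableP[mh _] := hi.
have [N [mN N0 DN]] := (ae_eq_integral_abs nu mD mh).1 int0.
apply/eqP; rewrite -measure_le0 -N0; apply: le_measure; rewrite ?inE//.
move=> x Ax; apply: DN => /= E; have := ltgf x Ax.
by rewrite -subr_gt0; have [->] := E (AD _ Ax); rewrite ltxx.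
Qed.

Section velocity_kernel.
Context {R : realType}.
Variables (n : nat) (alpha : R).
Hypotheses (n0 : (0 < n)%N) (alpha2 : alpha < 2) (alphan : 2 - alpha <= n%:R).
Implicit Types s rho : R.

(** By homogeneity, [s] enters only through [phi q / q] at [q = s / rho]. *)
Lemma velocity_kernel_div s rho : 0 < s -> 0 < rho ->
  @velocity_kernel R n.+2 alpha s rho / s =
  @phi R n.+2 alpha (s / rho) / (s / rho) * (rho `^ (alpha - 1) / rho).
Proof.
move=> s0 rho0; rewrite /velocity_kernel gt_eqF//.
by field; rewrite !gt_eqF.
Qed.

(** A mass at the origin contributes [1 / s ^ (2 - alpha)], strictly decreasing as [alpha < 2]. For
    [0 < rho < s2] the ratio [s2 / rho] exceeds 1, where [phi q / q] decreases strictly. *)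
Lemma velocity_kernel_div_lt s1 s2 rho : 0 < s1 -> s1 < s2 -> 0 <= rho -> rho < s2 ->
  @velocity_kernel R n.+2 alpha s2 rho / s2 <
  @velocity_kernel R n.+2 alpha s1 rho / s1.
Proof.
move=> s10 s12 rho0 rhos2; have s20 : 0 < s2 by exact: lt_trans s12.
have [rhoE|rhoN0] := eqVneq rho 0.
  have E s : 0 < s -> @velocity_kernel R n.+2 alpha s rho / s = (s `^ (2 - alpha))^-1.
    move=> s0; rewrite /velocity_kernel rhoE eqxx -powR_inv1 ?ltW// -powRD.
      by rewrite -powRN; congr (_ `^ _); ring.
    by rewrite (gt_eqF s0) implybT.
  rewrite [ltLHS](E _ s20) [ltRHS](E _ s10) ltf_pV2 ?posrE ?powR_gt0//.
  by rewrite gt0_ltr_powR ?subr_gt0// nnegrE ltW.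
have {}rho0 : 0 < rho by rewrite lt_neqAle eq_sym rhoN0.
rewrite [ltLHS](velocity_kernel_div s20 rho0).
rewrite [ltRHS](velocity_kernel_div s10 rho0).
have c0 : 0 < rho `^ (alpha - 1) / rho by rewrite divr_gt0 ?powR_gt0.
have pq : s1 / rho < s2 / rho by rewrite ltr_pM2r ?invr_gt0.
have q1 : 1 < s2 / rho by rewrite ltr_pdivlMr// mul1r.
have := phi_div_decreasing n0 alpha2 alphan (divr_gt0 s10 rho0) pq q1.
by rewrite -(ltr_pM2r c0).
Qed.

Lemma velocity_kernel_div_le s1 s2 rho : 0 < s1 -> s1 < s2 -> 0 <= rho ->
  @velocity_kernel R n.+2 alpha s2 rho / s2 <=
  @velocity_kernel R n.+2 alpha s1 rho / s1.
Proof.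
move=> s10 s12 rho0; have [rhos2|rhos2] := ltP rho s2.
  by apply/ltW/velocity_kernel_div_lt.
have rho1 : 0 < rho by apply: lt_le_trans rhos2; exact: lt_trans s12.
have s20 : 0 < s2 by exact: lt_trans s12.
rewrite [leLHS](velocity_kernel_div s20 rho1).
rewrite [leRHS](velocity_kernel_div s10 rho1).
have c0 : 0 < rho `^ (alpha - 1) / rho by rewrite divr_gt0 ?powR_gt0.
have pq : s1 / rho <= s2 / rho by rewrite ler_pM2r ?invr_gt0// ltW.
have := phi_div_nonincreasing n0 alpha2 alphan (divr_gt0 s10 rho1) pq.
by rewrite -(ler_pM2r c0).
Qed.

(* Radii [s1 < s2] with the same rate of contraction would force the radial law
   to charge no radius below [s2], not even those close to [s1]. *)
Lemma radial_law_lt_eq0 (mu : probability 'rV[R]_n.+2 R) (l s1 s2 : R) :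
  0 < s1 -> s1 < s2 ->
  (forall s, s = s1 \/ s = s2 ->
    (radial_law mu).-integrable `[0, +oo[
      (fun rho => (@velocity_kernel R n.+2 alpha s rho)%:E) /\
    \int[radial_law mu]_(rho in `[0, +oo[) @velocity_kernel R n.+2 alpha s rho = l * s) ->
  radial_law mu `[0, s2[%classic = 0%E.
Proof.
move=> s10 s12 H; have s20 : 0 < s2 by exact: lt_trans s12.
have [i1 e1] := H s1 (or_introl erefl); have [i2 e2] := H s2 (or_intror erefl).
have lt rho : rho < s2 -> 0 <= rho -> (@velocity_kernel R n.+2 alpha s2 rho) / s2 <
   @velocity_kernel R n.+2 alpha s1 rho / s1.
  by move=> ? ?; exact: velocity_kernel_div_lt.
have le rho : 0 <= rho -> (@velocity_kernel R n.+2 alpha s2 rho) / s2 <=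
   @velocity_kernel R n.+2 alpha s1 rho / s1.
  by move=> ?; exact: velocity_kernel_div_le.
move: (@velocity_kernel R n.+2 alpha s1) (@velocity_kernel R n.+2 alpha s2)
  i1 e1 i2 e2 lt le => k1 k2 i1 e1 i2 e2 lt le.
have mI : measurable (`[0%R, +oo[%classic : set R) by exact: measurable_itv.
have iZ (s : R) (k : R -> R) :
    (radial_law mu).-integrable `[0, +oo[ (fun rho => (k rho)%:E) ->
    (radial_law mu).-integrable `[0, +oo[ (EFin \o (fun rho => s^-1 * k rho)).
  by move=> i; apply: (integrableZl mI s^-1 i).
apply: (@le_Rintegral_eq_null _ _ R (radial_law mu) `[0, +oo[%classic _
  (fun rho => s1^-1 * k1 rho) (fun rho => s2^-1 * k2 rho)) => //.
- by move=> rho; rewrite /= !in_itv/= andbT => /andP[].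
- exact: iZ.
- exact: iZ.
- by move=> rho; rewrite /= in_itv/= andbT ![_^-1 * _]mulrC; exact: le.
- by move=> rho; rewrite /= in_itv/= ![_^-1 * _]mulrC => /andP[rho0 rhos]; exact: lt.
(* Both integrals, divided by their radius, equal [l]. *)
- rewrite !RintegralZl// e1 e2 mulrCA mulVf ?gt_eqF// mulrCA mulVf ?gt_eqF//.
Qed.

(** If [|x| < |y|], the ball about [x] of radius [|y| - |x|] lies in the region below radius [|y|],
    which carries no mass; this contradicts [x] being in the support. *)
Lemma msupport_radius_unique (mu : probability 'rV[R]_n.+2 R) (l : R)
    (x y : 'rV[R]_n.+2) :
  (forall x, msupport mu x -> finite_velocity alpha mu x) ->
  (forall x, msupport mu x -> velocity alpha mu x = l *: x) ->
  msupport mu x -> msupport mu y -> x != 0 -> y != 0 -> enorm x = enorm y.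
Proof.
move=> fin vel; wlog xy : x y / enorm x < enorm y.
  move=> W xs ys x0 y0; have [xy|yx|//] := ltgtP (enorm x) (enorm y).
    by have := W _ _ xy xs ys x0 y0.
  by rewrite (W _ _ yx ys xs y0 x0).
move=> xs ys x0 y0; exfalso.
have e0 z : z != 0 :> 'rV[R]_n.+2 -> 0 < enorm z.
  by move=> z0; rewrite lt_neqAle enorm_ge0 eq_sym enorm_eq0 z0.
(* The velocity is minus the integral times [z / |z|]; comparing coefficients of [z != 0] gives the
   rate [- l]. *)
have rate z : msupport mu z -> z != 0 ->
    \int[radial_law mu]_(rho in `[0, +oo[) @velocity_kernel R n.+2 alpha (enorm z) rho =
    - l * enorm z.
  move=> zs z0; have := vel z zs; rewrite /velocity (negbTE z0) scalerA.
  move/eqP; rewrite -subr_eq0 -scalerBl scaler_eq0 (negbTE z0) orbF subr_eq0 => /eqP E.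
  by rewrite -E; move: (Rintegral _ _ _) => I; field; rewrite gt_eqF ?e0.
have := @radial_law_lt_eq0 mu (- l) _ _ (e0 _ x0) xy.
case/(_ _)/Wrap => [s [->|->]|H].
- by split; [exact: fin|exact: rate].
- by split; [exact: fin|exact: rate].
have xy0 : 0 < enorm y - enorm x by rewrite subr_gt0.
have := xs _ xy0; rewrite ltNge => /negP; apply; rewrite -H.
apply: le_measure; rewrite ?inE.
- exact: measurable_ball_center.
- by rewrite -[X in measurable X]setTI; exact: measurable_enorm.
move=> z /= zx; rewrite in_itv/= enorm_ge0/=.
exact: (enorm_lt_add (e0 _ x0) xy).
Qed.

End velocity_kernel.

(** Time 0 is the left end of the lifespan, but arbitrarily small positive times belong to it; so
    the one-sided derivative at 0 is unique. *)
Lemma within_lifespan_proper (R : realType) (T0 : \bar R) : (0 < T0)%E ->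
  ProperFilter (within (lifespan T0) (0 : R)^').
Proof.
move=> T00; apply: Build_ProperFilter_ex => A.
rewrite /within/= => /nbhs_ballP[e /= e0 eA].
have [s s0 sT] : exists2 s : R, 0 < s & (s%:E < T0)%E.
  case: T0 T00 {eA} => [t|_|//]; last by exists 1; rewrite ?ltry.
  by rewrite lte_fin => t0; exists (t / 2); [rewrite divr_gt0|rewrite lte_fin; lra].
pose u := Num.min s (e / 2).
have u0 : 0 < u by rewrite lt_min s0 divr_gt0.
exists u; apply: eA; last 2 first.
- by rewrite gt_eqF.
- split; first exact: ltW.
  by apply: le_lt_trans sT; rewrite lee_fin ge_min lexx.
rewrite /ball/= sub0r normrN gtr0_norm// (@le_lt_trans _ _ (e / 2))//.
  by rewrite ge_min lexx orbT.
by lra.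
Qed.

Lemma is_derive_within_unique (R : realType) (V : normedModType R) (T0 : \bar R)
    (f : R -> V) (l1 l2 : V) : (0 < T0)%E ->
  is_derive_within (lifespan T0) f 0 l1 -> is_derive_within (lifespan T0) f 0 l2 ->
  l1 = l2.
Proof.
move=> T00 d1 d2; have ? := within_lifespan_proper T00.
exact: (cvg_unique (@norm_hausdorff _ _) d1 d2).
Qed.

(** The curve [t |-> rad t *: x] is differentiated at time 0 in two ways: by the flow equation and
    directly. Thus [l] is the derivative of [rad] at 0, the same for all [x]. *)
Lemma similarity_velocity (R : realType) (d : nat) (alpha : R) (T0 : \bar R)
    (rad : R -> R) (mu : R -> probability 'rV[R]_d R) :
  first_kind_similarity_solution alpha T0 rad mu ->
  exists l : R, forall x, msupport (mu 0) x -> velocity alpha (mu 0) x = l *: x.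
Proof.
move=> S; have T00 := fks_lifespan S.
have L0 : lifespan T0 0 by [].
have [l dl] := fks_rad_derivable S L0.
exists l => x xs; have := fks_flow S xs L0; rewrite (fks_rad0 S) scale1r => dx.
apply: (is_derive_within_unique T00 dx).
rewrite /is_derive_within.
rewrite (_ : (fun s => _) = (fun s => ((s - 0)^-1 *: (rad s - rad 0)) *: x)).
  exact: cvgZr_tmp.
by apply/funext => s; rewrite -scalerBl scalerA.
Qed.

(** Away from the two radii, the preimage of [I] under the norm avoids the support and is therefore
    negligible. *)
Lemma radial_law_two_atoms (R : realType) (d : nat) (mu : probability 'rV[R]_d R)
    (rho1 : R) : 0 < rho1 ->
  (forall x, msupport mu x -> enorm x = 0 \/ enorm x = rho1) ->
  forall I : set R, measurable I ->
    radial_law mu I = ((fine (radial_law mu [set 0%R]))%:E * \d_(0 : R)%R I +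
      (fine (radial_law mu [set rho1]))%:E * \d_rho1 I)%E.
Proof.
move=> rho0 H I mI.
have atom (r : R) : radial_law mu (I `&` [set r]) =
    ((fine (radial_law mu [set r]))%:E * \d_r I)%E.
  rewrite fineK ?fin_num_measure// diracE.
  have [rI|rI] := boolP (r \in I).
    by rewrite mule1; congr (radial_law mu _); apply/seteqP; split => [x []//|x /= ->];
      split => //; exact: set_mem.
  rewrite mule0 (_ : _ `&` _ = set0) ?measure0//; apply/seteqP; split => // x [Ix /= xr].
  by move: rI; rewrite -xr mem_set.
set J := (I `&` [set 0]) `|` (I `&` [set rho1]).
have mJ : measurable J by apply: measurableU; exact: measurableI.
have JI : J `<=` I by move=> x [][].
have JE : radial_law mu J = (radial_law mu (I `&` [set 0%R]) +
    radial_law mu (I `&` [set rho1]))%E.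
  rewrite measureU//; try exact: measurableI.
  apply/seteqP; split => // x [[_ /= x0] [_ /= x1]].
  by move: rho0; rewrite -x1 x0 ltxx.
rewrite -!atom -JE -[in LHS](setDUK JI) measureU//; last 2 first.
- exact: measurableD.
- exact: setDIK.
rewrite [X in (_ + X)%E](_ : _ = 0%E) ?adde0//.
have [N [mN N0 sN]] := negligible_msupportC mu.
apply/eqP; rewrite -measure_le0 -N0 -[leLHS]/(mu (@enorm R d @^-1` (I `\` J))).
apply: le_measure; rewrite ?inE//.
  by rewrite -[X in measurable X]setTI; apply: measurable_enorm => //; exact: measurableD.
move=> x /= [Ix nJ]; apply: sN => /= /H[x0|x1]; apply: nJ.
  by left; split.
by right; split.
Qed.

Theorem theorem3p1 (R : realType) (d : nat) (hd : (3 <= d)%N)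
    (alpha : R) (halpha1 : 4 - d%:R <= alpha) (halpha2 : alpha < 2)
    (T0 : \bar R) (rad : R -> R) (mu : R -> probability 'rV[R]_d R)
    (hmu : first_kind_similarity_solution alpha T0 rad mu) :
  (forall t : R, lifespan T0 t -> is_dilation (rad t) (mu 0) (mu t)) /\
  exists m0 m1 rho1 : R,
    [/\ 0 <= m0, 0 <= m1, 0 < rho1 &
      forall I : set R, measurable I -> I `<=` `[0, +oo[ ->
        radial_law (mu 0) I = (m0%:E * \d_(0 : R)%R I + m1%:E * \d_rho1 I)%E].
Proof.
split; first exact: fks_dilation hmu.
suff [rho1 rho10 H] : exists2 rho1 : R, 0 < rho1 &
    forall x, msupport (mu 0) x -> enorm x = 0 \/ enorm x = rho1.
  exists (fine (radial_law (mu 0) [set 0])), (fine (radial_law (mu 0) [set rho1])), rho1.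
  split; [by rewrite fine_ge0|by rewrite fine_ge0|by []|].
  by move=> I mI _; exact: radial_law_two_atoms.
case: d hd mu halpha1 hmu => [|[|n]]// n0 mu halpha1 hmu.
(* With [d = n + 2], the bound [4 - d <= alpha] is the superharmonicity condition [2 b <= n]. *)
have alphan : 2 - alpha <= n%:R.
  by move: halpha1; rewrite -[n.+2]addn2 natrD; lra.
have [l vel] := similarity_velocity hmu.
have fin x : msupport (mu 0) x -> finite_velocity alpha (mu 0) x.
  by apply: (fks_finite hmu); split => //; exact: fks_lifespan hmu.
have [[x xs x0]|nx] := pselect (exists2 x, msupport (mu 0) x & x != 0).
  exists (enorm x); first by rewrite lt_neqAle enorm_ge0 eq_sym enorm_eq0 x0.
  move=> y ys; have [->|y0] := eqVneq y 0.
    by left; apply/eqP; rewrite enorm_eq0.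
  by right; exact: (msupport_radius_unique n0 halpha2 alphan fin vel).
(* No support point lies off the origin: [rho1 = 1] is an arbitrary choice, and the atom there has
   mass zero. *)
exists 1 => // y ys; left; apply/eqP; rewrite enorm_eq0; apply/negPn/negP => y0.
by apply: nx; exists y.
Qed.
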